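(* Let $n\ge 1$, $\alpha>1$, and let $(p_A)_{A\subset[n]}$ be a probability distribution on subsets of $[n]$ with $p_\varnothing=0$. Let $(\vec X_t)_{t\ge 0}$ be the colour-proportion process of the WARM with $W(x)=x^\alpha$ and i.i.d. subsets with law $(p_A)$, and let $\mathcal A_\alpha$ be the (random) set of accumulation points of the sequence $(\vec X_t)_{t\ge0}$. Then: (i) almost surely, $\mathcal A_\alpha\subset\mathcal E_\alpha$ and $\mathcal A_\alpha$ is a connected subset of $\Delta_n$; (ii) $\mathbb P(\vec X_t\to\vec v \text{ as } t\to\infty)>0$ for every $\vec v\in\mathcal S_\alpha$.
   Context: Process. $[n]=\{1,\dots,n\}$ is the set of colours. $N^{(i)}_t$ is the number of balls of colour $i$ at time $t\in\{0,1,2,\dots\}$, with $N_0^{(i)}=1$ for all $i$. At each time $t\ge1$ a random subset $A_t\subset[n]$ is chosen, where the $(A_t)$ are i.i.d. with $\mathbb P(A_t=A)=p_A$ and $A_t$ is independent of the past $\sigma\{A_s,(N^{(i)}_s)_{i\in[n]}:s\le t-1\}$. Given $A_t$ and the past, a colour $i\in A_t$ is selected with probability $(N^{(i)}_{t-1})^\alpha/\sum_{j\in A_t}(N^{(j)}_{t-1})^\alpha$, and $N^{(j)}_t=N^{(j)}_{t-1}+\mathbf 1_{\{j=i\}}$ for all $j$. Put $\vec N_t=(N_t^{(i)})_{i\in[n]}$ and $\vec X_t=\vec N_t/(t+n)$. Equilibria. $\Delta_n=\{\vec u\in\mathbb R^n:u_i\ge0,\ \sum_i u_i=1\}$. For $\vec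 v\in\Delta_n$, $F(\vec v)_i=-v_i+\sum_{A\ni i}p_A\,\frac{v_i^\alpha}{\sum_{j\in A}v_j^\alpha}$ (with $0/0$ read as $0$; then $F(\vec v)=\vec 0$ forces $\sum_{j\in A}v_j>0$ whenever $p_A>0$). $\mathcal E_\alpha$ is the set of equilibria, i.e. of $\vec v\in\Delta_n$ with $F(\vec v)=\vec 0$. Stability. At an equilibrium $\vec v$, $\mathbf D(\vec v)$ is the $n\times n$ matrix with entries $D_{i,k}=\partial F(\vec v)_i/\partial v_k$, namely $D_{i,i}=-1+\alpha v_i^{\alpha-1}\sum_{A\ni i}p_A\frac{\sum_{j\in A}v_j^\alpha-v_i^\alpha}{(\sum_{j\in A}v_j^\alpha)^2}$ and, for $k\ne i$, $D_{i,k}=-\alpha v_k^{\alpha-1}v_i^\alpha\sum_{A\ni i,k}\frac{p_A}{(\sum_{j\in A}v_j^\alpha)^2}$. The equilibrium $\vec v$ is linearly stable if all eigenvalues of $\mathbf D(\vec v)$ have negative real parts. $\mathcal S_\alpha$ is the set of linearly-stable equilibria. *)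

(* Defs.v *)
From HB Require Import structures.
From mathcomp Require Import all_boot all_order all_algebra.
From mathcomp Require Import complex.
From mathcomp Require Import all_classical all_reals all_analysis.

Set Implicit Arguments.
Unset Strict Implicit.
Unset Printing Implicit Defensive.

Import Order.TTheory GRing.Theory Num.Theory.
Import numFieldNormedType.Exports.

Local Open Scope classical_set_scope.
Local Open Scope ring_scope.

(* The colours are 'I_n. *)

Definition is_subset_distr (R : realType) (n : nat) (p : {set 'I_n} -> R) : Prop :=
  (forall B, 0 <= p B) /\ \sum_(B : {set 'I_n}) p B = 1.

Section Equilibria.
Variables (R : realType) (n : nat) (alpha : R) (p : {set 'I_n} -> R).
Implicit Types (v : 'rV[R]_n) (B : {set 'I_n}) (i k : 'I_n).

Definition simplex : set 'rV[R]_n :=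
  [set v | (forall i, 0 <= v 0 i) /\ \sum_i v 0 i = 1].

Definition powsum v B : R := \sum_(j in B) v 0 j `^ alpha.

(* On the simplex [powsum v B = 0] only if [v] vanishes on [B], so the
   convention x / 0 = 0 of the library is exactly "0/0 read as 0". *)
Definition drift v : 'rV[R]_n :=
  \row_i (- v 0 i + \sum_(B : {set 'I_n} | i \in B) p B * (v 0 i `^ alpha / powsum v B)).

Definition equilibria : set 'rV[R]_n := [set v | simplex v /\ drift v = 0].

(* Closed form of the partial derivatives of [drift] at an equilibrium.  It is
   used in place of the library's derivative because an equilibrium may have
   zero coordinates, while [powR] has junk values on negative numbers.  At an
   equilibrium, a zero denominator can only occur together with [p B = 0]. *)
Definition drift_jacobian v : 'M[R]_n := \matrix_(i, k)
  if k == i then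
    -1 + alpha * v 0 i `^ (alpha - 1) *
      \sum_(B : {set 'I_n} | i \in B)
         p B * ((powsum v B - v 0 i `^ alpha) / powsum v B ^+ 2)
  else
    - (alpha * v 0 k `^ (alpha - 1) * v 0 i `^ alpha *
       \sum_(B : {set 'I_n} | (i \in B) && (k \in B)) p B / powsum v B ^+ 2).

Definition linearly_stable v : Prop :=
  forall z : R[i],
    eigenvalue (map_mx (real_complex R) (drift_jacobian v)) z ->
    complex.Re z < 0.

Definition stable_equilibria : set 'rV[R]_n :=
  [set v | equilibria v /\ linearly_stable v].

End Equilibria.

Section Process.
Variables (R : realType) (d : measure_display) (T : measurableType d).
Variables (n : nat).

(* The index 0 of [A] is unused: subsets are drawn at times t >= 1. *)
Definition past_events (A : nat -> T -> {set 'I_n}) (N : nat -> 'I_n -> T -> nat)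
    (t : nat) : set_system T :=
  <<s [set E | (exists s (Y : set {set 'I_n}),
                  [/\ (0 < s)%N, (s < t)%N & E = A s @^-1` Y])
            \/ (exists s i (Y : set nat), (s < t)%N /\ E = N s i @^-1` Y)] >>.

Definition past_and_subset_events (A : nat -> T -> {set 'I_n})
    (N : nat -> 'I_n -> T -> nat) (t : nat) : set_system T :=
  <<s past_events A N t `|` [set E | exists Y : set {set 'I_n}, E = A t @^-1` Y] >>.

Definition selection_prob (alpha : R) (u : 'I_n -> nat) (B : {set 'I_n})
    (i : 'I_n) : R :=
  if i \in B then (u i)%:R `^ alpha / \sum_(j in B) (u j)%:R `^ alpha else 0.

(* [A t], [C t] are the subset drawn and the colour selected at time t >= 1;
   [N t i] is the number of balls of colour i at time t >= 0. *)
Record is_WARM (alpha : R) (p : {set 'I_n} -> R) (P : probability T R)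
    (A : nat -> T -> {set 'I_n}) (C : nat -> T -> 'I_n)
    (N : nat -> 'I_n -> T -> nat) : Prop := IsWARM {
  subset_measurable : forall t (Y : set {set 'I_n}),
    (0 < t)%N -> measurable (A t @^-1` Y);
  colour_measurable : forall t (Y : set 'I_n),
    (0 < t)%N -> measurable (C t @^-1` Y);
  count_measurable : forall t i (Y : set nat), measurable (N t i @^-1` Y);
  count_init : forall i w, N 0%N i w = 1%N;
  count_step : forall t i w,
    (0 < t)%N -> N t i w = (N t.-1 i w + (i == C t w))%N;
  subset_law : forall t B, (0 < t)%N -> P (A t @^-1` [set B]) = (p B)%:E;
  subset_mutual_indep : forall (s : seq nat) (Y : nat -> set {set 'I_n}),
    uniq s -> all (fun t => 0 < t)%N s ->
    P (\bigcap_(t in [set` s]) A t @^-1` Y t)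
    = (\prod_(t <- s) P (A t @^-1` Y t))%E;
  subset_indep_past : forall t (Y : set {set 'I_n}) E,
    (0 < t)%N -> past_events A N t E ->
    P (E `&` A t @^-1` Y) = (P E * P (A t @^-1` Y))%E;
  (* the conditional probability of [C t = i] given [A t] and the past is
     [selection_prob alpha N_{t-1} A_t i] *)
  colour_cond_law : forall t i E,
    (0 < t)%N -> past_and_subset_events A N t E ->
    P (E `&` C t @^-1` [set i])
    = (\int[P]_(w in E)
         (selection_prob alpha (fun j => N t.-1 j w) (A t w) i)%:E)%E
}.

Definition proportions (N : nat -> 'I_n -> T -> nat) (t : nat) (w : T)
    : 'rV[R]_n :=
  \row_i ((N t i w)%:R / (t + n)%N%:R).

Definition accumulation_points (N : nat -> 'I_n -> T -> nat) (w : T)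
    : set 'rV[R]_n :=
  cluster ((fun t => proportions N t w) @ \oo).

End Process.

Arguments simplex : clear implicits.
Arguments proportions R {d T n} N t w.
Arguments accumulation_points R {d T n} N w.

(* Main.v *)
(** The drift is gradient-like: with
    [L x = alpha^-1 * \sum_B p_B ln (\sum_(j in B) x_j^alpha)] one has
    [drift_i = x_i (dL/dx_i - 1)], hence [<grad L, drift> >= |drift|^2] on the
    simplex.  The proportions move by [drift + noise] with steps [1/(t+1+n)], so
    [L] increases by [|drift|^2/(t+1+n)] up to a convergent martingale and a
    summable error.  As [L] is bounded above, the series of
    [|drift|^2/(t+1+n)] converges almost surely, which together with the
    Lipschitz continuity of the drift forces [drift -> 0]: accumulation points
    are equilibria, and they form a connected set since the increments tend to 0.

    At an equilibrium [v] the Jacobian is self-adjoint for the inner product with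
    weights [1/v_i] (1 if [v_i = 0]), so linear stability makes
    [Q x = \sum_i w_i (x_i - v_i)^2] decrease along the drift near [v], and
    isolates [v].  Hence [Q] is a supermartingale up to a summable error until it
    leaves a small ball.  Every composition close to [v] supported by the colours
    of [v] is reached with positive probability, and from there the process stays
    in the ball with probability at least 1/2. *)
Require Import Defs.
From mathcomp Require Import all_boot all_order all_algebra.
From mathcomp Require Import complex.
From mathcomp Require Import all_classical all_reals all_analysis.
From mathcomp Require Import zify ring lra.

Set Implicit Arguments.
Unset Strict Implicit.
Unset Printing Implicit Defensive.

Import Order.TTheory GRing.Theory Num.Theory.
Import numFieldNormedType.Exports.

Local Open Scope classical_set_scope.
Local Open Scope ring_scope.

(** * Powers *)

(** Convergence of the series of [|drift|^2/(t+1+n)] alone does not give [drift -> 0]: the drift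
    could come back to a fixed size on ever sparser stretches of time. What excludes this is that,
    once the Lyapunov function has nearly settled, a large drift persists over steps whose sizes add
    up to at least 1/2. This is a statement about a single trajectory perturbed by two Cauchy
    sequences; probability only supplies these sequences, through a maximal inequality.

    Faces of the simplex are the main obstacle. For [alpha < 2] the map [x^(alpha-1)] is not
    Lipschitz at 0, and an equilibrium may lie on a face, where only one-sided derivatives make
    sense. Both difficulties are met by one convexity inequality for [x^alpha] on the closed
    half-line.

    In the second claim, confinement near [v] does not itself give convergence. It is combined with
    the first claim: cluster points are equilibria, and the ball contains no equilibrium but [v].
    Hence an escape probability bounded below 1 suffices, with no rate of convergence. *)

Section PowerFunction.
Variables (R : realType) (alpha : R).
Hypothesis halpha : 1 < alpha.
Implicit Types x y v : R.

(** Young's inequality for [x^(alpha-1)] and [y] with conjugate exponents [alpha/(alpha-1)] and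
    [alpha]. Avoiding derivatives, it covers [x = 0] and [y = 0] as well. *)
Lemma powR_tangent x y : 0 <= x -> 0 <= y ->
  alpha * x `^ (alpha - 1) * (y - x) <= y `^ alpha - x `^ alpha.
Proof.
have ha := halpha; move=> x0 y0; have a0 : 0 < alpha by lra.
have a1 : 0 < alpha - 1 by lra.
have pe : (alpha / (alpha - 1))^-1 + alpha^-1 = 1 by field; rewrite !gt_eqF.
have := conjugate_powR (powR_ge0 x (alpha - 1)) y0 (divr_gt0 a0 a1) a0 pe.
rewrite -powRrM.
have -> : (alpha - 1) * (alpha / (alpha - 1)) = alpha by field; rewrite gt_eqF.
have e : x `^ alpha = x * x `^ (alpha - 1) by rewrite mulr_powRB1.
rewrite e; set t := x `^ (alpha - 1) => H.
have {}H := ler_wpM2l (ltW a0) H.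
suff : alpha * (x * t / (alpha / (alpha - 1)) + y `^ alpha / alpha)
  = (alpha - 1) * (x * t) + y `^ alpha by move=> E; rewrite E in H; nra.
by field; rewrite !gt_eqF.
Qed.

Lemma powR_le1 x r : 0 <= x <= 1 -> 0 <= r -> x `^ r <= 1.
Proof.
move=> /andP[x0 x1] r0; have <- : 1 `^ r = 1 by rewrite powR1.
by apply: ge0_ler_powR; rewrite ?nnegrE.
Qed.

(** The tangent inequality at either endpoint bounds the difference, and on the unit interval the
    slopes [alpha * x^(alpha-1)] are at most [alpha]. *)
Lemma powR_lipschitz x y : 0 <= x <= 1 -> 0 <= y <= 1 ->
  `|x `^ alpha - y `^ alpha| <= alpha * `|x - y|.
Proof.
have ha := halpha; move=> /andP[x0 x1] /andP[y0 y1].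
have := powR_tangent x0 y0; have := powR_tangent y0 x0.
have := @powR_le1 x (alpha - 1); have := @powR_le1 y (alpha - 1).
rewrite x0 x1 y0 y1 /= => /(_ isT) + /(_ isT).
have a1 : 0 <= alpha - 1 by lra.
move=> /(_ a1) + /(_ a1).
have := powR_ge0 x (alpha - 1); have := powR_ge0 y (alpha - 1).
set s := x `^ (alpha - 1); set t := y `^ (alpha - 1) => t0 s0 t1 s1 H1 H2.
have [xy|xy] := leP x y.
  have : x `^ alpha <= y `^ alpha by apply: ge0_ler_powR; rewrite ?nnegrE//; lra.
  move=> H; rewrite distrC ger0_norm ?subr_ge0// distrC ger0_norm ?subr_ge0//.
  apply: (@le_trans _ _ (alpha * t * (y - x))); first by nra.
  by rewrite -mulrA ler_wpM2l ?(ler_piMl)//; lra.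
have : y `^ alpha <= x `^ alpha by apply: ge0_ler_powR; rewrite ?nnegrE//; lra.
move=> H; rewrite ger0_norm ?subr_ge0// ger0_norm; last by rewrite subr_ge0 ltW.
apply: (@le_trans _ _ (alpha * s * (x - y))); first by nra.
by rewrite -mulrA ler_wpM2l ?(ler_piMl)//; lra.
Qed.

Lemma powR_continuous_nneg v r : 0 < r -> 0 <= v -> forall e, 0 < e ->
  exists2 d, 0 < d & forall x, 0 <= x -> `|x - v| < d -> `|x `^ r - v `^ r| < e.
Proof.
move=> r0; rewrite le_eqVlt => /predU1P[<-|v0] e e0.
  exists (e `^ r^-1); first by rewrite powR_gt0.
  move=> x x0; rewrite powR0 ?gt_eqF// !subr0 ger0_norm// ger0_norm ?powR_ge0// => H.
  have : x `^ r < (e `^ r^-1) `^ r by apply: gt0_ltr_powR; rewrite ?nnegrE ?powR_ge0.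
  by rewrite -powRrM mulVf ?gt_eqF// powRr1 // ltW.
have : {for v, continuous (@powR R ^~ r)}.
  apply: differentiable_continuous; apply/derivable1_diffP.
  by apply: derivable_powR; rewrite in_itv /= v0.
move/cvgrPdist_lt => /(_ e e0) /nbhs_ballP[d /= d0 H].
exists d => // x x0 xd; rewrite distrC; apply: H.
by rewrite /ball/= distrC.
Qed.

(** Tangents at both [v] and [x] squeeze the remainder between 0 and [alpha * (x^(alpha-1) -
    v^(alpha-1)) * (x - v)], so continuity of the power [alpha - 1] is enough, even at [v = 0]. *)
Lemma powR_expand v : 0 <= v -> forall e, 0 < e ->
  exists2 d, 0 < d & forall x, 0 <= x -> `|x - v| < d ->
   `|x `^ alpha - v `^ alpha - alpha * v `^ (alpha - 1) * (x - v)| <= e * `|x - v|.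
Proof.
have ha := halpha; move=> v0 e e0; have a1 : 0 < alpha - 1 by lra.
have ea : 0 < e / alpha by rewrite divr_gt0//; lra.
have [d d0 H] := powR_continuous_nneg a1 v0 ea.
exists d => // x x0 xv; have {}H := ltW (H x x0 xv).
have h1 := powR_tangent v0 x0; have h2 := powR_tangent x0 v0.
rewrite ger0_norm; last by rewrite subr_ge0.
apply: (@le_trans _ _ (alpha * ((x `^ (alpha - 1) - v `^ (alpha - 1)) * (x - v)))).
  by nra.
apply: (@le_trans _ _ (alpha * (e / alpha * `|x - v|))).
  rewrite ler_wpM2l //; first by lra.
  by apply: le_trans (ler_norm _) _; rewrite normrM ler_wpM2r.
by rewrite mulrA mulrCA divff ?mulr1 // gt_eqF //; lra.
Qed.

(** The left side equals [1 - s/t], so this is [ln (s/t) <= s/t - 1] displayed as a first-order term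
    in [t - s] minus a quadratic error. *)
Lemma ln_diff_ge (s t : R) : 0 < s -> 0 < t ->
  (t - s) / s - (t - s) ^+ 2 / (s * t) <= ln t - ln s.
Proof.
move=> s0 t0.
have st0 : 0 < s / t by rewrite divr_gt0.
have := @le_ln1Dx R (s / t - 1); rewrite addrCA subrr addr0 => H.
have {H} : ln (s / t) <= s / t - 1 by apply: H; lra.
rewrite ln_div ?posrE// => H.
suff : (t - s) / s - (t - s) ^+ 2 / (s * t) = 1 - s / t by move=> ->; lra.
by field; rewrite !gt_eqF.
Qed.

End PowerFunction.

(** * The drift and its Lyapunov function *)

Section RowNorm.
Variables (R : realType) (n : nat).
Implicit Types x y : 'rV[R]_n.

Lemma ler_coord_norm x i : `|x 0 i| <= `|x|.
Proof.
rewrite [leRHS]/Num.norm /= mx_normrE; apply/bigmax_geP; right => /=.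
by exists (0, i).
Qed.

Lemma norm_rV_le x c : 0 <= c -> (forall i, `|x 0 i| <= c) -> `|x| <= c.
Proof.
move=> c0 H; rewrite [leLHS]/Num.norm /= mx_normrE; apply/bigmax_leP; split=> //.
by move=> [i j] _ /=; rewrite (ord1 i).
Qed.

Lemma norm_rV_sqr x : `|x| ^+ 2 <= \sum_i x 0 i ^+ 2.
Proof.
have S0 : 0 <= \sum_i x 0 i ^+ 2 by apply: sumr_ge0 => i _; apply: sqr_ge0.
have : `|x| <= Num.sqrt (\sum_i x 0 i ^+ 2).
  apply: norm_rV_le; first exact: sqrtr_ge0.
  move=> i; rewrite -sqrtr_sqr ler_sqrt // (bigD1 i) //= lerDl.
  by apply: sumr_ge0 => j _; apply: sqr_ge0.
by rewrite -(@ler_pXn2r _ 2) ?nnegrE ?sqrtr_ge0// sqr_sqrtr.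
Qed.

End RowNorm.

Section Drift.
Variables (R : realType) (n : nat) (alpha : R) (p : {set 'I_n} -> R).
Hypotheses (halpha : 1 < alpha) (hp : is_subset_distr p).
Implicit Types (x y : 'rV[R]_n) (B : {set 'I_n}) (i : 'I_n).

Let p_ge0 B : 0 <= p B. Proof. by case: hp. Qed.

(* [drift] is discontinuous where a [powsum] vanishes.  The proportions
   eventually stay in this set, because colours of [B] are selected with
   asymptotic frequency at least [p B]. *)
Definition core : set 'rV[R]_n :=
  [set x | simplex R n x /\ forall B, p B / 2 <= \sum_(j in B) x 0 j].

(** The partial derivative of [lyapunov] in coordinate [i]; the factor [alpha^-1] there cancels the
    exponent. *)
Definition gain x i : R :=
  \sum_(B : {set 'I_n} | i \in B) p B * (x 0 i `^ (alpha - 1) / powsum alpha x B).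

Definition lyapunov x : R :=
  alpha^-1 * \sum_(B : {set 'I_n}) p B * ln (powsum alpha x B).

(** A mass of at least [p B / 2] on at most [n] coordinates forces one coordinate up to
    [p B / (2 n)]; the 4 leaves a margin, so that non-strict estimates already give a
    contradiction. *)
Definition powsum_lb B : R := (p B / (4 * n%:R)) `^ alpha.

Lemma simplex_le1 x i : simplex R n x -> 0 <= x 0 i <= 1.
Proof.
move=> [x0 xs]; rewrite x0 /= -xs (bigD1 i) //= lerDl.
by apply: sumr_ge0.
Qed.

Lemma powsum_ge0 x B : 0 <= powsum alpha x B.
Proof. by apply: sumr_ge0 => j _; apply: powR_ge0. Qed.

Lemma powR_le_powsum x B i : i \in B -> x 0 i `^ alpha <= powsum alpha x B.
Proof.
move=> iB; rewrite /powsum (bigD1 i) //= lerDl.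
by apply: sumr_ge0 => j _; apply: powR_ge0.
Qed.

Lemma powsum_gt0 x B : (forall i, 0 <= x 0 i) -> 0 < \sum_(j in B) x 0 j ->
  0 < powsum alpha x B.
Proof.
move=> x0 H; rewrite lt_neqAle powsum_ge0 andbT; apply/negP => /eqP/esym E.
move: H; rewrite big1 ?ltxx// => j jB.
apply/(@powR_eq0_eq0 _ _ alpha)/le_anti.
by rewrite powR_ge0 andbT -E powR_le_powsum.
Qed.

Lemma powsum_le_card x B : simplex R n x -> powsum alpha x B <= n%:R.
Proof.
have ha := halpha; move=> sx; apply: (@le_trans _ _ (\sum_(j in B) 1)).
  by apply: ler_sum => j _; apply: powR_le1; [exact: simplex_le1|lra].
by rewrite sumr_const ler_nat (leq_trans (max_card _)) ?card_ord.
Qed.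

Lemma core_powsum x B : core x -> 0 < p B ->
  0 < powsum_lb B <= powsum alpha x B.
Proof.
have ha := halpha; move=> [sx /(_ B) H] pB.
have n0 : (0 < n)%N.
  rewrite lt0n; apply/negP => /eqP n0; move: H; rewrite big1 ?leNgt; first by lra.
  by move=> i _; have /= := leq_ltn_trans (leq0n i) (ltn_ord i); rewrite [X in (_ < X)%N]n0.
have c0 : 0 < p B / (4 * n%:R) by rewrite divr_gt0// mulr_gt0 ?ltr0n.
rewrite powR_gt0 //=.
have [/existsP[j /andP[jB xj]]|/existsPn N] :=
    boolP [exists j, (j \in B) && (p B / (4 * n%:R) <= x 0 j)].
  apply: le_trans (powR_le_powsum x jB).
  by apply: ge0_ler_powR; rewrite ?nnegrE ?(ltW c0)//; [lra|case: sx].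
suff : \sum_(j in B) x 0 j <= p B / 4 by lra.
apply: (@le_trans _ _ (\sum_(j in B) p B / (4 * n%:R))).
  by apply: ler_sum => j jB; have := N j; rewrite jB /= -ltNge => /ltW.
rewrite sumr_const -[leLHS]mulr_natr.
apply: (@le_trans _ _ (p B / (4 * n%:R) * n%:R)).
  by rewrite ler_wpM2l ?(ltW c0)// ler_nat (leq_trans (max_card _)) ?card_ord.
suff -> : p B / (4 * n%:R) * n%:R = p B / 4 by [].
by field; rewrite pnatr_eq0 -lt0n.
Qed.

Lemma driftE x i : drift alpha p x 0 i =
  - x 0 i + \sum_(B : {set 'I_n} | i \in B) p B * (x 0 i `^ alpha / powsum alpha x B).
Proof. by rewrite mxE. Qed.

Lemma drift_gain x i : 0 <= x 0 i ->
  drift alpha p x 0 i = x 0 i * (gain x i - 1).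
Proof.
have ha := halpha; move=> x0; rewrite driftE mulrBr mulr1 addrC; congr (_ - _).
rewrite mulr_sumr; apply: eq_bigr => B _.
have a0 : 0 < alpha by lra.
by rewrite -(mulr_powRB1 x0 a0); ring.
Qed.

(** In each coordinate of [B] only the term of the subset [B] itself is kept; over [i \in B] these
    selection probabilities add up to 1. *)
Lemma sum_drift_subset x B : (forall i, 0 <= x 0 i) ->
  (0 < p B -> 0 < powsum alpha x B) ->
  p B - \sum_(i in B) x 0 i <= \sum_(i in B) drift alpha p x 0 i.
Proof.
move=> x0 H; under [leRHS]eq_bigr do rewrite driftE.
rewrite big_split /= sumrN addrC lerD2r.
apply: (@le_trans _ _ (\sum_(i in B) p B * (x 0 i `^ alpha / powsum alpha x B))).
  have := p_ge0 B; rewrite le_eqVlt => /predU1P[<-|pB].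
    by rewrite big1// => i _; rewrite mul0r.
  by rewrite -mulr_sumr -mulr_suml divff ?mulr1// gt_eqF// H.
apply: ler_sum => i iB; rewrite (bigD1 B)//= lerDl.
by apply: sumr_ge0 => C _; rewrite mulr_ge0// divr_ge0 ?powR_ge0// powsum_ge0.
Qed.

Lemma sum_drift x : simplex R n x -> (forall B, 0 < p B -> powsum alpha x B != 0) ->
  \sum_i drift alpha p x 0 i = 0.
Proof.
move=> [x0 xs] H; under eq_bigr do rewrite driftE.
rewrite big_split /= sumrN xs.
rewrite (exchange_big_dep predT)//=.
case: hp => _ <-; rewrite addrC -sumrB big1 // => B _.
have := p_ge0 B; rewrite le_eqVlt => /predU1P[<-|pB].
  by rewrite subr0 big1// => i _; rewrite mul0r.
by rewrite -mulr_sumr -mulr_suml divff ?mulr1 ?subrr// H.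
Qed.

Lemma gain_ge0 x i : 0 <= gain x i.
Proof.
by apply: sumr_ge0 => B _; rewrite mulr_ge0// divr_ge0 ?powR_ge0// powsum_ge0.
Qed.

Definition gain_ub : R := \sum_(B : {set 'I_n}) p B / powsum_lb B.

Lemma gain_le x i : core x -> gain x i <= gain_ub.
Proof.
have ha := halpha; move=> cx; rewrite /gain big_mkcond; apply: ler_sum => B _.
have lb0 : 0 <= powsum_lb B by apply: powR_ge0.
case: ifP => iB; last by rewrite divr_ge0.
have := p_ge0 B; rewrite le_eqVlt => /predU1P[<-|pB]; first by rewrite !mul0r.
have /andP[l0 l1] := core_powsum cx pB.
rewrite ler_wpM2l// ler_pdivrMr ?(lt_le_trans l0)//.
apply: (@le_trans _ _ 1); last by rewrite mulrC ler_pdivlMr// mul1r.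
by apply: powR_le1; [case: cx => cx _; exact: simplex_le1|lra].
Qed.

(** As the drift sums to 0, [gain] may be replaced by [gain - 1]. The right side becomes the sum of
    [x_i (gain_i - 1)^2], which dominates [drift_i^2 = x_i^2 (gain_i - 1)^2] termwise because
    [x_i <= 1]. *)
Lemma drift_le_gain x : core x ->
  `|drift alpha p x| ^+ 2 <= \sum_i gain x i * drift alpha p x 0 i.
Proof.
move=> cx; have [sx _] := cx; have [x0 xs] := sx.
apply: le_trans (norm_rV_sqr _) _.
have E0 : \sum_i drift alpha p x 0 i = 0.
  apply: sum_drift => // B pB.
  by have /andP[l0 l1] := core_powsum cx pB; rewrite gt_eqF// (lt_le_trans l0).
rewrite -[leRHS]subr0 -[X in _ - X]E0.
rewrite -sumrB; apply: ler_sum => i _; rewrite (drift_gain (x0 i)).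
have /andP[xi0 xi1] := simplex_le1 i sx.
have -> : gain x i * (x 0 i * (gain x i - 1)) - x 0 i * (gain x i - 1) = x 0 i * (gain x i - 1) ^+ 2 by ring.
rewrite exprMn ler_wpM2r ?sqr_ge0//; nra.
Qed.

(** Collects the quadratic errors of [ln_diff_ge]: [alpha * n] is the Lipschitz constant of
    [powsum], and [powsum_lb B ^+ 2] bounds the product [s * t] from below. *)
Definition lyapunov_const : R :=
  alpha^-1 * \sum_(B : {set 'I_n}) p B * ((alpha * n%:R) ^+ 2 / powsum_lb B ^+ 2).

Lemma powsum_lipschitz x y B : simplex R n x -> simplex R n y ->
  `|powsum alpha x B - powsum alpha y B| <= alpha * n%:R * `|x - y|.
Proof.
have ha := halpha; move=> sx sy; rewrite /powsum -sumrB.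
apply: le_trans (ler_norm_sum _ _ _) _.
have a0 : 0 <= alpha by lra.
apply: (@le_trans _ _ (\sum_(j in B) alpha * `|x - y|)).
  apply: ler_sum => j _; apply: le_trans (powR_lipschitz ha _ _) _; try exact: simplex_le1.
  by rewrite ler_wpM2l//; have := ler_coord_norm (x - y) j; rewrite !mxE.
rewrite sumr_const -[alpha * _ * _]mulrAC -[leLHS]mulr_natr ler_wpM2l ?mulr_ge0//.
by rewrite ler_nat (leq_trans (max_card _)) ?card_ord.
Qed.

(* Convexity of [x `^ alpha] makes this one-sided bound second order even for
   [alpha < 2], where the gradient [gain] is not Lipschitz. *)
Lemma lyapunov_step x y : core x -> core y ->
  lyapunov x + \sum_i gain x i * (y 0 i - x 0 i) - lyapunov_const * `|y - x| ^+ 2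
  <= lyapunov y.
Proof.
have ha := halpha; move=> cx cy; rewrite -addrA -lerBrDl /lyapunov -mulrBr -sumrB.
have a0 : 0 < alpha by lra.
have -> : \sum_i gain x i * (y 0 i - x 0 i) = alpha^-1 * \sum_(B : {set 'I_n})
   p B * (\sum_(i in B) alpha * x 0 i `^ (alpha - 1) * (y 0 i - x 0 i) / powsum alpha x B).
  under eq_bigr do rewrite mulr_suml.
  rewrite (exchange_big_dep predT)//= mulr_sumr; apply: eq_bigr => B _.
  rewrite !mulr_sumr; apply: eq_bigr => i _.
  rewrite [RHS](_ : _ = (alpha^-1 * alpha) * (p B * (x 0 i `^ (alpha - 1) / powsum alpha x B)
       * (y 0 i - x 0 i))); last by ring.
  by rewrite mulVf ?mul1r ?gt_eqF.
rewrite /lyapunov_const -mulrA -mulrBr ler_wpM2l ?invr_ge0 ?(ltW a0)//.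
rewrite mulr_suml -sumrB; apply: ler_sum => B _.
rewrite -[p B * _ * `|_| ^+ 2]mulrA -!mulrBr.
have := p_ge0 B; rewrite le_eqVlt => /predU1P[<-|pB]; first by rewrite !mul0r.
rewrite ler_wpM2l//.
have /andP[l0 lx] := core_powsum cx pB; have /andP[_ ly] := core_powsum cy pB.
have sx0 := lt_le_trans l0 lx; have sy0 := lt_le_trans l0 ly.
(* The linear part is then bounded below by the tangent inequality, without remainder; only the
   quadratic part uses the Lipschitz bound. *)
apply: le_trans (ln_diff_ge sx0 sy0).
case: cx => sx _; case: cy => sy _.
apply: lerB.
  rewrite -mulr_suml ler_wpM2r ?invr_ge0 ?(ltW sx0)//.
  rewrite /powsum -sumrB; apply: ler_sum => i _; apply: powR_tangent => //.
    by case: sx.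
  by case: sy.
rewrite [leRHS]mulrAC -exprMn; apply: ler_pM; rewrite ?sqr_ge0 ?invr_ge0 ?mulr_ge0 ?(ltW sx0) ?(ltW sy0)//.
  rewrite -[leLHS]real_normK ?num_real// ler_pXn2r ?nnegrE ?mulr_ge0 ?(ltW a0)//.
  exact: powsum_lipschitz.
by rewrite lef_pV2 ?posrE ?exprn_gt0 ?mulr_gt0// expr2 ler_pM // ltW.
Qed.

Lemma lyapunov_le x : core x ->
  lyapunov x <= alpha^-1 * \sum_(B : {set 'I_n}) p B * n%:R.
Proof.
have ha := halpha; move=> cx; rewrite ler_wpM2l ?invr_ge0; [|lra|].
  by [].
apply: ler_sum => B _.
have := p_ge0 B; rewrite le_eqVlt => /predU1P[<-|pB]; first by rewrite !mul0r.
have /andP[l0 lx] := core_powsum cx pB; have sx0 := lt_le_trans l0 lx.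
rewrite ler_wpM2l// (le_trans (ltW (ln_sublinear sx0)))//.
by case: cx => cx _; exact: powsum_le_card.
Qed.

Definition drift_lip : R :=
  1 + \sum_(B : {set 'I_n}) p B * ((alpha + alpha * n%:R) / powsum_lb B).

Lemma drift_lip_gt0 : 0 < drift_lip.
Proof.
have ha := halpha; have a0 : 0 <= alpha by lra.
rewrite ltr_wpDr// sumr_ge0// => B _.
by rewrite mulr_ge0// divr_ge0 ?addr_ge0 ?mulr_ge0// powR_ge0.
Qed.

Lemma drift_lipschitz x y : core x -> core y ->
  `|drift alpha p x - drift alpha p y| <= drift_lip * `|x - y|.
Proof.
have ha := halpha; have a0 : 0 <= alpha by lra.
move=> cx cy; apply: norm_rV_le; first by rewrite mulr_ge0// ltW// drift_lip_gt0.
move=> i; rewrite !mxE.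
set S := \sum_(B | _) _; set S' := \sum_(B | _) _.
have -> : - x 0 i + S - (- y 0 i + S') = - (x 0 i - y 0 i) + (S - S') by ring.
apply: le_trans (ler_normD _ _) _; rewrite normrN mulrDl mul1r lerD//.
  by have := ler_coord_norm (x - y) i; rewrite !mxE.
rewrite /S /S' -sumrB mulr_suml big_mkcond.
apply: le_trans (ler_norm_sum _ _ _) _; apply: ler_sum => B _.
have K0 : 0 <= (alpha + alpha * n%:R) / powsum_lb B.
  by rewrite divr_ge0 ?addr_ge0 ?mulr_ge0// powR_ge0.
case: ifP => iB; last by rewrite normr0 mulr_ge0 ?(mulr_ge0 (p_ge0 B) K0).
rewrite -mulrBr normrM ger0_norm// -mulrA.
have := p_ge0 B; rewrite le_eqVlt => /predU1P[<-|pB]; first by rewrite !mul0r.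
rewrite ler_wpM2l//.
have /andP[l0 lx] := core_powsum cx pB; have /andP[_ ly] := core_powsum cy pB.
have sx0 := lt_le_trans l0 lx; have sy0 := lt_le_trans l0 ly.
case: cx => sx _; case: cy => sy _.
have ay := powR_le_powsum y iB; have ay0 := powR_ge0 (y 0 i) alpha.
have H1 : `|x 0 i `^ alpha - y 0 i `^ alpha| <= alpha * `|x - y|.
  apply: le_trans (powR_lipschitz ha _ _) _; try exact: simplex_le1.
  by rewrite ler_wpM2l//; have := ler_coord_norm (x - y) i; rewrite !mxE.
have H2 := powsum_lipschitz B sx sy.
move: ay ay0 H1 H2.
set a := x 0 i `^ alpha; set b := y 0 i `^ alpha.
set s := powsum alpha x B; set t := powsum alpha y B => ay ay0 H1 H2.
(* In this form [b / t <= 1], so a lower bound on the single denominator [s] controls the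
   difference. *)
have -> : a / s - b / t = ((a - b) - b / t * (s - t)) / s.
  by field; rewrite !gt_eqF.
rewrite normrM normfV (gtr0_norm sx0) [leRHS]mulrAC.
apply: ler_pM; rewrite ?invr_ge0 ?(ltW sx0)//; last by rewrite lef_pV2 ?posrE.
apply: le_trans (ler_normB _ _) _; rewrite mulrDl lerD//.
rewrite normrM; apply: le_trans H2; rewrite ler_piMl// ger0_norm ?divr_ge0// ?(ltW sy0)//.
by rewrite ler_pdivrMr ?mul1r.
Qed.

End Drift.

(** * Vanishing of the drift along perturbed trajectories *)

(** Adding a ball of colour [c] at time [t + 1] moves the proportions by [1/(t+1+n)] times the unit
    vector of [c] minus the current proportions. *)
Definition step_size {R : realType} (n t : nat) : R := (t.+1 + n)%:R^-1.

Lemma step_size_gt0 {R : realType} n t : 0 < step_size n t :> R.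
Proof. by rewrite /step_size invr_gt0 ltr0n. Qed.

(** Telescoping: the squared steps from time [m] on add up to at most [1/(m+n)]. Every summable
    error below is paid for in this way. *)
Lemma step_size_sqr_le {R : realType} n t : (0 < n)%N ->
  step_size n t ^+ 2 <= (t + n)%:R^-1 - (t.+1 + n)%:R^-1 :> R.
Proof.
move=> n0; rewrite /step_size addSn -[(t + n).+1]addn1 natrD.
have : 0 < (t + n)%:R :> R by rewrite ltr0n addn_gt0 n0 orbT.
set u : R := (t + n)%:R => u0.
have -> : u^-1 - (u + 1)^-1 = (u * (u + 1))^-1 by field; rewrite !gt_eqF//; lra.
rewrite exprVn expr2 lef_pV2 ?posrE; try nra.
Qed.

Lemma nondecreasing_tail (R : realType) (W : nat -> R) (T : nat) (M : R) :
  (forall t, (T <= t)%N -> W t <= W t.+1) -> (forall t, (T <= t)%N -> W t <= M) ->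
  forall e, 0 < e -> exists2 m, (T <= m)%N & forall t, (m <= t)%N -> W t - W m <= e.
Proof.
move=> nd bd e e0.
pose A := [set W t | t in [set t | (T <= t)%N]].
have hA : has_sup A.
  by split; [exists (W T); exists T => /= | exists M => _ [t /= Tt <-]; exact: bd].
have [_ [m /= Tm <-] Hm] := sup_adherent e0 hA.
exists m => // t mt.
have := ub_le_sup hA.2 (ex_intro2 _ _ t (leq_trans Tm mt) erefl : A (W t)).
lra.
Qed.

(* If [|F t| >= 2 e] at a late time, [x] moves too little for [|F|] to drop below
   [e] afterwards, since every move costs an increase of [W]; then [W] grows
   along the harmonic steps by more than its tail allows. *)
Lemma perturbed_ascent_vanishes (R : realType) (E : normedModType R) (n T0 : nat)
    (x U F : nat -> E) (W : nat -> R) (lip bd : R) :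
  (0 < n)%N -> 0 < lip ->
  (forall t, x t.+1 = x t + step_size n t *: F t + (U t.+1 - U t)) ->
  (forall e, 0 < e -> exists m, forall s, (m <= s)%N -> `|U s - U m| <= e) ->
  (forall t, (T0 <= t)%N -> W t + step_size n t * `|F t| ^+ 2 <= W t.+1) ->
  (forall t, (T0 <= t)%N -> W t <= bd) ->
  (forall s t, (T0 <= s)%N -> (T0 <= t)%N -> `|F s - F t| <= lip * `|x s - x t|) ->
  forall e, 0 < e -> exists m, forall t, (m <= t)%N -> `|F t| < e.
Proof.
move=> hn lip0 x_step U_cauchy W_step W_bd F_lip.
have W_nd t : (T0 <= t)%N -> W t <= W t.+1.
  move=> Tt; apply: le_trans (W_step t Tt).
  by rewrite lerDl mulr_ge0 ?sqr_ge0// ltW// step_size_gt0.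
have W_mono s t : (T0 <= s)%N -> (s <= t)%N -> W s <= W t.
  move=> Ts; elim: t => [|t IH]; first by rewrite leqn0 => /eqP->.
  rewrite leq_eqVlt => /predU1P[<-//|]; rewrite ltnS => st.
  by apply: le_trans (IH st) (W_nd _ (leq_trans Ts st)).
move=> e2 e20.
have [e e0 e2E] : exists2 e, 0 < e & e2 = 2 * e.
  by exists (e2 / 2); [rewrite divr_gt0|rewrite mulrCA divff ?mulr1].
(* A displacement of at most [d] changes [F] by at most [e], hence keeps [|F|] above [e] if it
   starts above [2 e]. *)
have [d d0 lipd] : exists2 d, 0 < d & lip * d = e.
  by exists (e / lip); [rewrite divr_gt0|rewrite mulrCA divff ?mulr1// gt_eqF].
have ed0 : 0 < e * d by rewrite mulr_gt0.
have ee0 : 0 < e ^+ 2 by rewrite exprn_gt0.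
(* [eta] is the remaining growth of [W]. The bound [e * d / 2] limits the noise-free displacement to
   [d / 2]; [e ^+ 2 / 4] is below the growth [e ^+ 2 / 2] obtained at the end. *)
have [eta [eta0 eta1 eta2]] : exists eta, [/\ 0 < eta, eta <= e * d / 2 & eta <= e ^+ 2 / 4].
  exists (Num.min (e * d / 2) (e ^+ 2 / 4)).
  by rewrite lt_min !ge_min !lexx orbT; split=> //; apply/andP; split; lra.
have [m2 T0m2 Wm2] := nondecreasing_tail W_nd W_bd eta0.
have [|m3 Hm3] := U_cauchy (d / 4); first by rewrite divr_gt0.
exists (maxn m2 m3) => t; rewrite geq_max => /andP[m2t m3t].
have Tt := leq_trans T0m2 m2t.
rewrite ltNge; apply/negP => big; rewrite {}e2E in big.
have Weta s : (t <= s)%N -> W s - W t <= eta.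
  move=> ts; have := Wm2 s (leq_trans m2t ts); have := W_mono m2 t T0m2 m2t; lra.
have U_small s : (t <= s)%N -> `|U s - U t| <= d / 2.
  move=> ts; have -> : U s - U t = (U s - U m3) - (U t - U m3).
    by rewrite opprB addrA subrK.
  apply: le_trans (ler_normB _ _) _.
  have := Hm3 s (leq_trans m3t ts); have := Hm3 t m3t; lra.
(* Without its noise the path moves by [step_size * F] only, so while [|F| >= e] its displacement
   times [e] is at most the gain of [W]. *)
pose D s := x s - U s.
have D_step s : D s.+1 = D s + step_size n s *: F s.
  by rewrite /D x_step -addrA (addrAC (U _)) subrr add0r addrAC.
have x_D s : x s - x t = (D s - D t) + (U s - U t).
  by rewrite addrACA -opprD /D !subrK.
have stay k : `|D (t + k)%N - D t| * e <= W (t + k)%N - W t -> e <= `|F (t + k)%N|.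
  move=> H; have tk : (t <= t + k)%N := leq_addr k t.
  have h1 : `|D (t + k)%N - D t| <= d / 2.
    rewrite -(ler_pM2r e0); apply: le_trans H _; apply: le_trans (Weta _ tk) _.
    by apply: le_trans eta1 _; lra.
  have h2 : `|x t - x (t + k)%N| <= d.
    rewrite distrC x_D; apply: le_trans (ler_normD _ _) _.
    have := U_small _ tk; lra.
  have := F_lip _ _ Tt (leq_trans Tt tk).
  have := ler_wpM2l (ltW lip0) h2; rewrite lipd.
  have := lerB_dist (F t) (F (t + k)%N).
  lra.
have close k : `|D (t + k)%N - D t| * e <= W (t + k)%N - W t.
  elim: k => [|k IH]; first by rewrite addn0 !subrr normr0 mul0r.
  have f := stay k IH.
  rewrite addnS; have := W_step (t + k)%N (leq_trans Tt (leq_addr _ _)).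
  rewrite D_step addrAC.
  have := ler_normD (D (t + k)%N - D t) (step_size n (t + k) *: F (t + k)%N).
  have g0 : 0 < step_size n (t + k) :> R := step_size_gt0 _ _.
  rewrite normrZ (gtr0_norm g0) => /(ler_wpM2r (ltW e0)).
  rewrite mulrDl => h1 h2.
  have : step_size n (t + k) * `|F (t + k)%N| * e <= step_size n (t + k) * `|F (t + k)%N| ^+ 2.
    rewrite -mulrA expr2; apply: (ler_wpM2l (ltW g0)).
    exact: (ler_wpM2l (normr_ge0 _)).
  lra.
have tn0 : 0 < (t + n)%:R :> R by rewrite ltr0n addn_gt0 hn orbT.
(* The [t + n] steps after time [t] each have size at least [1 / (2 (t + n))], so together at least
   1/2. *)
have grow k : (k <= t + n)%N -> e ^+ 2 * (k%:R / (2 * (t + n)%:R)) <= W (t + k)%N - W t.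
  elim: k => [|k IH] kt; first by rewrite mul0r mulr0 addn0 subrr.
  rewrite addnS; have := W_step (t + k)%N (leq_trans Tt (leq_addr _ _)).
  have := IH (ltnW kt); have f := stay k (close k).
  have g1 : (2 * (t + n)%:R)^-1 <= step_size n (t + k) :> R.
    rewrite /step_size -natrM lef_pV2 ?posrE ?ltr0n ?muln_gt0 ?addn_gt0 ?hn ?orbT//.
    by rewrite ler_nat; clear -kt; lia.
  have : (2 * (t + n)%:R)^-1 * e ^+ 2 <= step_size n (t + k) * `|F (t + k)%N| ^+ 2.
    have g0 : 0 <= (2 * (t + n)%:R)^-1 :> R by rewrite invr_ge0 mulr_ge0// ltW.
    apply: (ler_pM g0 (sqr_ge0 e) g1).
    by rewrite ler_pXn2r ?nnegrE ?normr_ge0 ?(ltW e0).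
  rewrite -[in k.+1%:R]addn1 natrD mulrDl mulrDr mul1r; lra.
have := grow (t + n)%N (leqnn _); have := Weta (t + (t + n))%N (leq_addr _ _).
have -> : (t + n)%:R / (2 * (t + n)%:R) = 2^-1 :> R by rewrite invfM mulrCA divff ?mulr1// gt_eqF.
lra.
Qed.

(** * One trajectory of the proportions with convergent noise *)

Section ODEMethod.
Variables (R : realType) (n : nat) (alpha : R) (p : {set 'I_n} -> R).
Hypotheses (hn : (0 < n)%N) (halpha : 1 < alpha) (hp : is_subset_distr p)
  (hp0 : p finset.set0 = 0).
(* [U] accumulates the martingale noise of the proportions, and [V] its first
   order effect on the Lyapunov function. *)
Variables (x U : nat -> 'rV[R]_n) (V : nat -> R).
Hypothesis x_simplex : forall t, simplex R n (x t).
Hypothesis x_gt0 : forall t i, 0 < x t 0 i.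
Hypothesis x_step : forall t,
  x t.+1 = x t + step_size n t *: drift alpha p (x t) + (U t.+1 - U t).
Hypothesis x_incr : forall t, `|x t.+1 - x t| <= step_size n t.
Hypothesis V_step : forall t, core p (x t) ->
  V t.+1 - V t = \sum_i gain alpha p (x t) i * (U t.+1 - U t) 0 i.
Hypothesis U_cauchy : forall e, 0 < e ->
  exists m, forall s, (m <= s)%N -> `|U s - U m| <= e.
Hypothesis V_cauchy : forall e, 0 < e ->
  exists m, forall s, (m <= s)%N -> `|V s - V m| <= e.

Let p_ge0 B : 0 <= p B. Proof. by case: hp. Qed.

(** By [sum_drift_subset] the mass [y] of [B] has drift at least [p B - y]; after subtraction of the
    convergent noise it is pushed up towards [p B]. *)
Lemma subset_mass_lower B : exists T, forall t, (T <= t)%N ->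
  p B / 2 <= \sum_(j in B) x t 0 j.
Proof.
have := p_ge0 B; rewrite le_eqVlt => /predU1P[<-|pB].
  exists 0%N => t _; rewrite mul0r; apply: sumr_ge0 => j _.
  by case: (x_simplex t).
pose y t := \sum_(j in B) x t 0 j; pose M t := \sum_(j in B) U t 0 j.
(* Three losses of [e] occur: in the level [c], in the approach of [z] to [c], and in passing from
   [z] back to [y]. They leave [p B - 3 e = p B / 2]. *)
pose e := p B / 6; have e0 : 0 < e by rewrite divr_gt0.
have [m Hm] : exists m, forall s, (m <= s)%N -> `|M s - M m| <= e.
  have en : 0 < e / n%:R by rewrite divr_gt0 ?ltr0n.
  have [m Hm] := U_cauchy en; exists m => s ms.
  rewrite /M -sumrB; apply: le_trans (ler_norm_sum _ _ _) _.
  apply: (@le_trans _ _ (\sum_(j in B) e / n%:R)).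
    apply: ler_sum => j _; apply: le_trans (Hm s ms).
    by have := ler_coord_norm (U s - U m) j; rewrite !mxE.
  rewrite sumr_const -[leLHS]mulr_natr.
  apply: (@le_trans _ _ (e / n%:R * n%:R)).
    by rewrite ler_wpM2l ?(ltW en)// ler_nat (leq_trans (max_card _)) ?card_ord.
  by rewrite divfK// pnatr_eq0 -lt0n.
have y_step t : y t + step_size n t * (p B - y t) + (M t.+1 - M t) <= y t.+1.
  rewrite /y /M x_step.
  have -> : \sum_(j in B) (x t + step_size n t *: drift alpha p (x t) + (U t.+1 - U t)) 0 j
     = \sum_(j in B) x t 0 j + step_size n t * (\sum_(j in B) drift alpha p (x t) 0 j)
       + (\sum_(j in B) U t.+1 0 j - \sum_(j in B) U t 0 j).
    by rewrite mulr_sumr -sumrB -!big_split /=; apply: eq_bigr => j _; rewrite !mxE.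
  rewrite lerD2r lerD2l ler_wpM2l ?(ltW (step_size_gt0 _ _))//.
  have x0 i : 0 <= x t 0 i by apply: ltW.
  apply: sum_drift_subset => // pB'; apply: powsum_gt0 => //.
  rewrite lt_neqAle sumr_ge0// andbT eq_sym; apply/negP => /eqP E.
  have [B0|[j jB]] := set_0Vmem B; first by rewrite B0 hp0 ltxx in pB.
  move: E; rewrite (bigD1 j)//= => E.
  have : 0 <= \sum_(i in B | i != j) x t 0 i by apply: sumr_ge0.
  by have := x_gt0 t j; lra.
(* [(s + n) (z_s - c)] is nondecreasing, as [1 - step_size n s = (s + n) / (s.+1 + n)]. *)
pose c := p B - e; pose z t := y t - (M t - M m).
have z_step s : (m <= s)%N -> (s + n)%:R * (z s - c) <= (s.+1 + n)%:R * (z s.+1 - c).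
  move=> ms; have := y_step s; have := Hm s ms; rewrite ler_norml => /andP[_ h2] h3.
  have : z s - c - step_size n s * (z s - c) <= z s.+1 - c.
    suff : step_size n s * (c - z s) <= step_size n s * (p B - y s) by rewrite /z; lra.
    by rewrite ler_wpM2l ?(ltW (step_size_gt0 _ _))// /z /c; lra.
  have s0 : 0 < (s.+1 + n)%:R :> R by rewrite ltr0n.
  rewrite -(ler_pM2l s0) mulrBr mulrA /step_size divff ?gt_eqF// mul1r.
  by rewrite addSn -[(s + n).+1]addn1 natrD; lra.
have z_lb s : (m <= s)%N -> (m + n)%:R * (z m - c) <= (s + n)%:R * (z s - c).
  by elim: s => [|s IH]; [rewrite leqn0 => /eqP->
    |rewrite leq_eqVlt => /predU1P[<-//|]; rewrite ltnS => ms; apply: le_trans (IH ms) (z_step _ ms)].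
pose D := (m + n)%:R * (z m - c).
pose T := (m + Num.bound (`|D| / e))%N.
exists T => t Tt.
have mt : (m <= t)%N by apply: leq_trans Tt; apply: leq_addr.
have t0 : 0 < (t + n)%:R :> R by rewrite ltr0n addn_gt0 hn orbT.
have : - e <= z t - c.
  rewrite -(ler_pM2l t0); apply: le_trans (z_lb t mt); rewrite -/D.
  have : `|D| / e < (t + n)%:R.
    apply: (@lt_le_trans _ _ (Num.bound (`|D| / e))%:R).
      by apply: archi_boundP; rewrite divr_ge0// ltW.
    by rewrite ler_nat (leq_trans _ (leq_addr _ _))// (leq_trans _ Tt)// leq_addl.
  rewrite ltr_pdivrMr// => H.
  have := ler_norm (- D); rewrite normrN; lra.
have := Hm t mt; rewrite ler_norml => /andP[h1 h2].
rewrite /z /c -/(y t) /e in h1 h2 *; lra.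
Qed.

Lemma eventually_core : exists T, forall t, (T <= t)%N -> core p (x t).
Proof.
have [f Hf] := choice subset_mass_lower.
exists (\max_B f B) => t Tt; split=> // B; apply: Hf.
by apply: leq_trans Tt; apply: leq_bigmax.
Qed.

Lemma drift_vanishes : forall e, 0 < e ->
  exists T, forall t, (T <= t)%N -> core p (x t) /\ `|drift alpha p (x t)| < e.
Proof.
have ha := halpha.
have [T0 HT0] := eventually_core.
pose K := lyapunov_const alpha p.
have K0 : 0 <= K.
  rewrite /K /lyapunov_const mulr_ge0 ?invr_ge0//; first by lra.
  by apply: sumr_ge0 => B _; rewrite mulr_ge0// divr_ge0 ?sqr_ge0.
(* [V] removes the first-order effect of the noise, and the decrease of [K / (t + n)] absorbs the
   second-order error [K * step_size ^+ 2]. *)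
pose W t := lyapunov alpha p (x t) - V t - K * (t + n)%:R^-1.
have W_step t : (T0 <= t)%N -> W t + step_size n t * `|drift alpha p (x t)| ^+ 2 <= W t.+1.
  move=> Tt; have ct := HT0 t Tt; have ct1 := HT0 t.+1 (leqW Tt).
  have := lyapunov_step halpha hp ct ct1.
  have -> : \sum_i gain alpha p (x t) i * (x t.+1 0 i - x t 0 i) =
     step_size n t * (\sum_i gain alpha p (x t) i * drift alpha p (x t) 0 i) + (V t.+1 - V t).
    rewrite V_step// mulr_sumr -big_split /=; apply: eq_bigr => i _.
    by rewrite x_step !mxE; ring.
  have g0 : 0 < step_size n t :> R := step_size_gt0 n t.
  have := ler_wpM2l (ltW g0) (drift_le_gain halpha hp ct).
  have : K * `|x t.+1 - x t| ^+ 2 <= K * (t + n)%:R^-1 - K * (t.+1 + n)%:R^-1.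
    rewrite -mulrBr ler_wpM2l//; apply: le_trans (step_size_sqr_le t hn).
    by rewrite ler_pXn2r ?nnegrE// ltW.
  by rewrite /W -/K; lra.
have [m1 Hm1] := V_cauchy ltr01.
pose bd := alpha^-1 * \sum_(B : {set 'I_n}) p B * n%:R - V m1 + 1.
have W_bd t : (maxn T0 m1 <= t)%N -> W t <= bd.
  rewrite geq_max => /andP[Tt mt].
  have := lyapunov_le halpha hp (HT0 t Tt).
  have := Hm1 t mt; rewrite ler_norml => /andP[h1 _].
  have : 0 <= K * (t + n)%:R^-1 by rewrite mulr_ge0// invr_ge0.
  by rewrite /W /bd; lra.
have late t : (maxn T0 m1 <= t)%N -> (T0 <= t)%N := leq_trans (leq_maxl _ _).
have F_lip s t : (maxn T0 m1 <= s)%N -> (maxn T0 m1 <= t)%N ->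
    `|drift alpha p (x s) - drift alpha p (x t)| <= drift_lip alpha p * `|x s - x t|.
  by move=> /late Ts /late Tt; apply: drift_lipschitz => //; exact: HT0.
move=> e e0.
have [m Hm] := perturbed_ascent_vanishes hn (@drift_lip_gt0 R n alpha p halpha hp)
  x_step U_cauchy (fun t H => W_step t (late t H)) W_bd F_lip e0.
exists (maxn T0 m) => t; rewrite geq_max => /andP[Tt mt].
by split; [exact: HT0 | exact: Hm].
Qed.

End ODEMethod.

(** * Cluster sets of sequences with vanishing increments *)

Section SequenceClusters.
Variables (R : realType) (n : nat).
Implicit Types (x : nat -> 'rV[R]_n) (y v : 'rV[R]_n).

(** The filter [within P \oo] plays the part of the subsequence of times satisfying [P]; it is used
    for the crossing times in the connectedness argument. *)
Lemma cluster_frequently x y (P : nat -> Prop) :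
  cluster (x @ within P \oo) y -> forall e T, 0 < e ->
  exists t, [/\ (T <= t)%N, P t & `|x t - y| < e].
Proof.
move=> cy e T e0.
have := cy (x @` [set t | (T <= t)%N /\ P t]) (ball y e).
case.
- rewrite /within /=; exists T => // t /= Tt Pt; exists t => //.
- exact: nbhsx_ballx.
- move=> _ [[t [Tt Pt] <-] /=]; rewrite -ball_normE /= distrC => H.
  by exists t.
Qed.

Lemma cluster_frequentlyT x y : cluster (x @ \oo) y -> forall e T, 0 < e ->
  exists2 t, (T <= t)%N & `|x t - y| < e.
Proof.
move=> cy e T e0; have [|t [Tt _ H]] := @cluster_frequently x y setT _ e T e0.
  move=> A B FA; apply: cy; move: FA; rewrite /within /= !nbhs_simpl /=.
  apply: filterS => t /= H. by apply: H.
by exists t.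
Qed.

Lemma within_frequently_proper (P : nat -> Prop) :
  (forall T, exists2 t, (T <= t)%N & P t) -> ProperFilter (within P \oo).
Proof.
move=> H; apply: Build_ProperFilter_ex.
by move=> A [T _ TA]; have [t Tt Pt] := H T; exists t; apply: TA.
Qed.

Lemma cluster_closed (F : set_system 'rV[R]_n) : closed (cluster F).
Proof.
by rewrite clusterE; apply: closed_bigI => A _; apply: closed_closure.
Qed.

Lemma norm_ball_compact (c : R) : compact [set y : 'rV[R]_n | `|y| <= c].
Proof.
apply: bounded_closed_compact.
  by exists c; split; [exact: num_real|move=> M cM y /= /le_trans; apply; exact: ltW].
have -> : [set y : 'rV[R]_n | `|y| <= c] = (fun y => `|y|) @^-1` [set z | z <= c] by [].
apply: preimage_closed; last exact: closed_le.
by move=> y _; apply: norm_continuous.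
Qed.

Lemma cvg_unique_cluster x v (c : R) : (forall t, `|x t| <= c) ->
  (forall y, cluster (x @ \oo) y -> y = v) -> x @ \oo --> v.
Proof.
move=> xc H.
(* The radius makes the compact ball both a neighbourhood of [v] and large enough to contain the
   sequence. *)
apply: (@compact_cluster_set1 _ v _ [set y | `|y| <= `|v| + 1 + c]).
- exact: norm_hausdorff.
- exact: norm_ball_compact.
- apply/nbhs_ballP; exists 1 => //= y; rewrite -ball_normE /= => vy.
  have := ler_normB v (v - y); rewrite opprB addrC subrK => h.
  have := le_trans (normr_ge0 _) (xc 0%N); lra.
- by exists 0%N => // t _ /=; apply: le_trans (xc t) _; have := normr_ge0 v; lra.
apply/seteqP; split=> [y /H -> //|_ ->].
have pf : ProperFilter (x @ \oo) by apply: fmap_proper_filter.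
have [|y [_ cy]] := @norm_ball_compact c (x @ \oo) pf.
  by exists 0%N => // t _; exact: xc.
by rewrite -(H y cy).
Qed.

Lemma discrete_crossing (f : nat -> R) (a : R) (s t : nat) : (s <= t)%N ->
  f s <= a -> a < f t -> exists2 r, (s <= r)%N & f r <= a /\ a < f r.+1.
Proof.
elim: t => [|t IH]; first by rewrite leqn0 => /eqP-> /le_lt_trans /[apply]; rewrite ltxx.
rewrite leq_eqVlt => /predU1P[->|]; first by move=> /le_lt_trans /[apply]; rewrite ltxx.
rewrite ltnS => st fs ft.
by have [fta|/IH] := leP (f t) a; [exists t | exact].
Qed.

Lemma connected_cluster x (c : R) : (forall t, `|x t| <= c) ->
  (forall e, 0 < e -> exists T, forall t, (T <= t)%N -> `|x t.+1 - x t| < e) ->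
  connected (cluster (x @ \oo)).
Proof.
(* Two separated pieces would be crossed infinitely often, by ever smaller steps;
   a cluster point of the crossing times lies in neither piece. *)
move=> xc xincr B [b Bb] [Co oCo BO] [Cc cCc BD].
set A := cluster (x @ \oo) in BO BD *.
have cA : closed A by apply: cluster_closed.
apply/seteqP; split; first by rewrite BO; apply: subIsetl.
move=> b' Ab'; apply: contrapT => nB.
have cB : closed B by rewrite BD; apply: closedI.
have cB' : closed (A `&` ~` Co) by apply: closedI => //; apply: open_closedC.
have BB' : B `&` (A `&` ~` Co) = set0.
  by rewrite BO -subset0 => z [[_ +] [_]].
(* A Urysohn function, 0 on one piece and 1 on the other, turns passing between the pieces into an
   upcrossing of the level 1/2. *)
have /(uniform_separatorP (R := R))[f [fc _ f0 f1]] :=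
  (normal_separatorP (R := R)).1 pseudometric_normal _ _ cB cB' BB'.
have fB z : B z -> f z = 0 by move=> Bz; apply: f0; exists z.
have fB' z : A z -> ~ B z -> f z = 1.
  by move=> Az nBz; apply: f1; exists z => //; split=> // Cz; apply: nBz; rewrite BO.
have Ab : A b by move: Bb; rewrite BO => -[].
have near_f z (e : R) : 0 < e -> exists2 d, 0 < d & forall y, `|y - z| < d -> `|f y - f z| < e.
  move=> e0; have /cvgrPdist_lt /(_ e e0) /nbhs_ballP[d /= d0 H] := fc z.
  exists d => // y yz; rewrite distrC; apply: H.
  by rewrite -ball_normE /= distrC.
pose P t := f (x t) <= 1/2 /\ 1/2 < f (x t.+1).
have Pio T : exists2 t, (T <= t)%N & P t.
  have [d0 d00 H0] := near_f b (1/2) ltac:(lra).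
  have [d1 d10 H1] := near_f b' (1/2) ltac:(lra).
  have [s Ts /H0] := cluster_frequentlyT Ab T d00.
  have [t st /H1] := cluster_frequentlyT Ab' s d10.
  rewrite (fB _ Bb) (fB' _ Ab' nB) !ltr_norml => /andP[h1 _] /andP[_ h2].
  have [||r sr Pr] := @discrete_crossing (f \o x) (1/2) s t st; rewrite /=; clear BO BD BB'; try lra.
  by exists r; [exact: leq_trans Ts sr | exact: Pr].
have pf := within_frequently_proper Pio.
have [|y [_ cy]] := @norm_ball_compact c (x @ within P \oo) _.
  by rewrite /within /=; exists 0%N => // t _ _; exact: xc.
have Ay : A y.
  move=> S S' FS; apply: cy; move: FS; rewrite /within /= !nbhs_simpl /=.
  by apply: filterS => t.
have [d d0 Hd] := near_f y (1/4) ltac:(lra).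
have [T HT] := xincr (d / 2) ltac:(by rewrite divr_gt0).
have d20 : 0 < d / 2 by rewrite divr_gt0.
have [t [Tt [Pt1 Pt2] xy]] := cluster_frequently cy T d20.
have := Hd (x t); have := Hd (x t.+1).
have [/fB ->|/(fB' _ Ay) ->] := pselect (B y); rewrite !ltr_norml.
  have : `|x t.+1 - y| < d.
    clear BO BD BB'; have := ler_normD (x t.+1 - x t) (x t - y); rewrite addrA subrK.
    have := HT t Tt; lra.
  by clear BO BD BB'; move=> h /(_ h) /andP[_ h1]; lra.
have : `|x t - y| < d by clear BO BD BB'; lra.
by clear BO BD BB'; move=> h _ /(_ h) /andP[h1 h2]; lra.
Qed.

End SequenceClusters.

(** * Cluster points of a trajectory with vanishing drift *)

Section ClusterEquilibria.
Variables (R : realType) (n : nat) (alpha : R) (p : {set 'I_n} -> R).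
Hypotheses (halpha : 1 < alpha) (hp : is_subset_distr p).

(** All inequalities defining [core] are non-strict, so it is closed. The cluster point must be
    placed there first, since the drift is known to be Lipschitz only on [core]. *)
Lemma cluster_core (x : nat -> 'rV[R]_n) y : (exists T, forall t, (T <= t)%N -> core p (x t)) ->
  cluster (x @ \oo) y -> core p y.
Proof.
move=> [T HT] cy.
have near_y (e : R) : 0 < e -> exists2 z, core p z & `|z - y| < e.
  move=> e0; have [t Tt H] := cluster_frequentlyT cy T e0.
  by exists (x t) => //; exact: HT.
have coord_near z (e : R) i : `|z - y| < e -> `|z 0 i - y 0 i| <= e.
  by move=> H; have := ler_coord_norm (z - y) i; rewrite !mxE => /le_trans; apply; exact: ltW.
have sum_near z (e : R) (B : {set 'I_n}) : 0 < e -> `|z - y| < e ->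
    `|\sum_(j in B) z 0 j - \sum_(j in B) y 0 j| <= n%:R * e.
  move=> e0 H; rewrite -sumrB; apply: le_trans (ler_norm_sum _ _ _) _.
  apply: (@le_trans _ _ (\sum_(j in B) e)).
    by apply: ler_sum => j _; apply: coord_near.
  rewrite sumr_const -[leLHS]mulr_natl ler_wpM2r ?(ltW e0)//.
  by rewrite ler_nat (leq_trans (max_card _)) ?card_ord.
have small (e : R) : 0 < e -> 0 < e / (n%:R + 1) /\ n%:R * (e / (n%:R + 1)) <= e.
  move=> e0; have n1 : 0 < n%:R + 1 :> R by rewrite ltr_wpDl.
  split; first by rewrite divr_gt0.
  by rewrite mulrCA ler_piMr ?(ltW e0)// ler_pdivrMr// mul1r lerDl.
have [y0 ys yB] : [/\ (forall i, 0 <= y 0 i), \sum_i y 0 i = 1 &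
    forall B, p B / 2 <= \sum_(j in B) y 0 j].
  split.
  - move=> i; apply/ler_addgt0Pr => e e0.
    have [z [[z0 _] _] /(@coord_near _ _ i)] := near_y e e0.
    by rewrite ler_norml => /andP[_]; have := z0 i; lra.
  - apply/eqP; rewrite eq_sym -subr_eq0 -normr_le0; apply/ler_addgt0Pr => e e0; rewrite add0r.
    have [e1 e2] := small e e0.
    have [z [[_ zs] _] /(sum_near _ _ [set: 'I_n]%SET e1)] := near_y _ e1.
    under eq_bigl do rewrite finset.in_setT; under [X in _ - X]eq_bigl do rewrite finset.in_setT.
    by rewrite zs => /le_trans; apply.
  - move=> B; apply/ler_addgt0Pr => e e0; have [e1 e2] := small e e0.
    have [z [_ zB] /(sum_near _ _ B e1)] := near_y _ e1.
    by rewrite ler_norml => /andP[_]; have := zB B; lra.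
by [].
Qed.

Lemma cluster_equilibrium (x : nat -> 'rV[R]_n) y :
  (forall e, 0 < e -> exists T, forall t, (T <= t)%N ->
     core p (x t) /\ `|drift alpha p (x t)| < e) ->
  cluster (x @ \oo) y -> equilibria alpha p y.
Proof.
move=> H cy; have [T1 HT1] := H 1 ltr01.
have cory : core p y.
  by apply: cluster_core cy; exists T1 => t /HT1[].
split; first by case: cory.
have lip0 := @drift_lip_gt0 R n alpha p halpha hp.
apply/eqP; rewrite -normr_le0; apply/ler_addgt0Pr => e e0; rewrite add0r.
have e20 : 0 < e / 2 by rewrite divr_gt0.
have [T HT] := H _ e20.
have d0 : 0 < e / 2 / drift_lip alpha p by rewrite divr_gt0.
have [t Tt xy] := cluster_frequentlyT cy T d0.
have [ct ft] := HT t Tt.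
have := drift_lipschitz halpha hp ct cory.
have := ler_wpM2l (ltW lip0) (ltW xy).
rewrite [leRHS]mulrC divfK ?gt_eqF//.
have := lerB_dist (drift alpha p y) (drift alpha p (x t)); rewrite distrC.
lra.
Qed.

End ClusterEquilibria.

(** * Finite histories of the urn *)

Section Histories.
Variables (R : realType) (n : nat) (alpha : R) (p : {set 'I_n} -> R).
Hypotheses (hn : (0 < n)%N) (hp : is_subset_distr p) (hp0 : p finset.set0 = 0).

(* Histories list the draws with the most recent first.  Their law is explicit,
   so expectations over histories of length [t] are finite sums ([mean t]) and
   no conditional expectation is needed. *)
Definition draw : finType := ({set 'I_n} * 'I_n)%type.
Implicit Types (h : seq draw) (x : draw) (f g : seq draw -> R) (B : {set 'I_n}).

Let p_ge0 B : 0 <= p B. Proof. by case: hp. Qed.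

Definition balls h (i : 'I_n) : nat := (count (fun x : draw => x.2 == i) h).+1.

Definition fractions h : 'rV[R]_n := \row_i ((balls h i)%:R / (size h + n)%:R).

Definition step_prob h x : R := p x.1 * selection_prob alpha (balls h) x.1 x.2.

Definition colour_prob h (i : 'I_n) : R :=
  \sum_(B : {set 'I_n}) p B * selection_prob alpha (balls h) B i.

Fixpoint law h : R := if h is x :: h' then law h' * step_prob h' x else 1.

Fixpoint mean (t : nat) f : R :=
  if t is t'.+1 then mean t' (fun h => \sum_x step_prob h x * f (x :: h)) else f [::].

Fixpoint words (t : nat) : seq (seq draw) :=
  if t is t'.+1 then [seq x :: h | h <- words t', x <- enum draw] else [:: [::]].

Lemma sum_balls h : (\sum_i balls h i = size h + n)%N.
Proof.
elim: h => [|x h IH].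
  by rewrite /balls /= sum_nat_const card_ord muln1.
rewrite (eq_bigr (fun i => (x.2 == i) + balls h i)%N); last first.
  by move=> i _; rewrite /balls /= addnS.
rewrite big_split /= IH (bigD1 x.2)//= eqxx big1 ?addn0//.
by move=> i /negPf; rewrite eq_sym => ->.
Qed.

Lemma fractions_gt0 h i : 0 < fractions h 0 i.
Proof. by rewrite mxE divr_gt0 ?ltr0n// addn_gt0 hn orbT. Qed.

Lemma fractions_simplex h : simplex R n (fractions h).
Proof.
split=> [i|]; first exact/ltW/fractions_gt0.
under eq_bigr do rewrite mxE.
rewrite -mulr_suml -natr_sum sum_balls divff// pnatr_eq0 -lt0n addn_gt0 hn orbT//.
Qed.

Lemma fractions_cons x h i :
  fractions (x :: h) 0 i = fractions h 0 i + step_size n (size h) * ((x.2 == i)%:R - fractions h 0 i).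
Proof.
rewrite !mxE /balls /= -addnS natrD /step_size addSn -[(size h + n).+1]addn1 natrD.
have : 0 < (size h + n)%:R :> R by rewrite ltr0n addn_gt0 hn orbT.
set u := (size h + n)%:R => u0.
by field; rewrite !gt_eqF//; lra.
Qed.

Lemma fractions_incr x h : `|fractions (x :: h) - fractions h| <= step_size n (size h).
Proof.
have g0 := @step_size_gt0 R n (size h).
apply: norm_rV_le; first exact: ltW.
move=> i; have := fractions_cons x h i; have := simplex_le1 i (fractions_simplex h).
set c := fractions h 0 i => /andP[c0 c1] E.
have -> : (fractions (x :: h) - fractions h) 0 i = step_size n (size h) * ((x.2 == i)%:R - c).
  have -> : (fractions (x :: h) - fractions h) 0 i = fractions (x :: h) 0 i - fractions h 0 i by rewrite !mxE.
  by rewrite E addrAC subrr add0r.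
rewrite normrM gtr0_norm// ler_piMr ?(ltW g0)// ler_norml.
by case: eqP => _; apply/andP; split; rewrite /=; lra.
Qed.

Lemma selection_prob_ge0 h B i : 0 <= selection_prob alpha (balls h) B i :> R.
Proof.
rewrite /selection_prob; case: ifP => // _; rewrite divr_ge0 ?powR_ge0//.
by apply: sumr_ge0 => j _; exact: powR_ge0.
Qed.

Lemma sum_ballspow_gt0 h B i : i \in B -> 0 < \sum_(j in B) (balls h j)%:R `^ alpha.
Proof.
move=> iB; rewrite (bigD1 i)//= ltr_wpDr ?powR_gt0 ?ltr0n//.
by apply: sumr_ge0 => j _; exact: powR_ge0.
Qed.

Lemma selection_prob_gt0 h B i : i \in B -> 0 < selection_prob alpha (balls h) B i :> R.
Proof.
move=> iB; rewrite /selection_prob iB divr_gt0 ?powR_gt0 ?ltr0n//.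
exact: sum_ballspow_gt0 iB.
Qed.

Lemma sum_selection_prob h B : B != finset.set0 ->
  \sum_i selection_prob alpha (balls h) B i = 1.
Proof.
move=> /set0Pn[i iB]; rewrite /selection_prob -big_mkcond /= -mulr_suml divff//.
by rewrite gt_eqF// (sum_ballspow_gt0 _ iB).
Qed.

Lemma colour_prob_ge0 h i : 0 <= colour_prob h i.
Proof. by apply: sumr_ge0 => B _; rewrite mulr_ge0// selection_prob_ge0. Qed.

Lemma sum_colour_prob h : \sum_i colour_prob h i = 1.
Proof.
rewrite exchange_big /=; case: hp => _ <-; apply: eq_bigr => B _.
rewrite -mulr_sumr; have [->|B0] := eqVneq B finset.set0; first by rewrite hp0 mul0r.
by rewrite sum_selection_prob// mulr1.
Qed.

Lemma colour_prob_le1 h i : colour_prob h i <= 1.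
Proof.
rewrite -(sum_colour_prob h) (bigD1 i)//= lerDl.
by apply: sumr_ge0 => j _; exact: colour_prob_ge0.
Qed.

Lemma sum_colour_prob_centered h i (c : R) :
  \sum_j colour_prob h j * ((j == i)%:R - c) = colour_prob h i - c.
Proof.
move: (sum_colour_prob h); move: (colour_prob h) => q q1.
under eq_bigr do rewrite mulrBr.
rewrite sumrB -mulr_suml q1 mul1r; congr (_ - _).
rewrite (bigD1 i)//= eqxx mulr1 big1 ?addr0// => j /negPf ->.
by rewrite mulr0.
Qed.

(** Selection probabilities are homogeneous of degree 0, so ball counts may be divided by their
    total. *)
Lemma colour_prob_drift h i : colour_prob h i = fractions h 0 i + drift alpha p (fractions h) 0 i.
Proof.
rewrite driftE addrA addrN add0r [RHS]big_mkcond; apply: eq_bigr => B _.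
rewrite /selection_prob; case: ifP => iB; last by rewrite mulr0.
congr (_ * _).
have u0 : 0 < (size h + n)%:R :> R by rewrite ltr0n addn_gt0 hn orbT.
have E j : fractions h 0 j `^ alpha = (balls h j)%:R `^ alpha * (size h + n)%:R^-1 `^ alpha.
  by rewrite mxE powRM// invr_ge0.
rewrite /powsum E; under [in RHS]eq_bigr do rewrite E.
rewrite -mulr_suml invfM mulrACA divff ?mulr1//.
by rewrite gt_eqF// powR_gt0// invr_gt0.
Qed.

Lemma step_prob_ge0 h x : 0 <= step_prob h x.
Proof. by rewrite mulr_ge0// selection_prob_ge0. Qed.

Lemma law_ge0 h : 0 <= law h.
Proof. by elim: h => //= x h IH; rewrite mulr_ge0// step_prob_ge0. Qed.

Lemma sum_step_colour h (phi : 'I_n -> R) :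
  \sum_x step_prob h x * phi x.2 = \sum_i colour_prob h i * phi i.
Proof.
rewrite -(pair_bigA _ (fun B i => step_prob h (B, i) * phi i)) /= exchange_big /=.
by apply: eq_bigr => i _; rewrite mulr_suml.
Qed.

Lemma sum_step h : \sum_x step_prob h x = 1.
Proof.
rewrite -(sum_colour_prob h); have := sum_step_colour h (fun=> 1).
by under eq_bigr do rewrite mulr1; under [RHS]eq_bigr do rewrite mulr1.
Qed.

Lemma le_mean t f g : (forall h, size h = t -> f h <= g h) -> mean t f <= mean t g.
Proof.
elim: t f g => [|t IH] f g H /=; first exact: H.
apply: IH => h ht; apply: ler_sum => x _; rewrite ler_wpM2l ?step_prob_ge0//.
by apply: H; rewrite /= ht.
Qed.

Lemma eq_mean t f g : (forall h, size h = t -> f h = g h) -> mean t f = mean t g.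
Proof. by move=> H; apply/le_anti; rewrite !le_mean// => h /H ->. Qed.

Lemma meanD t f g : mean t (fun h => f h + g h) = mean t f + mean t g.
Proof.
elim: t f g => //= t IH f g; rewrite -IH; apply: eq_mean => h _.
by rewrite -big_split; apply: eq_bigr => x _; rewrite mulrDr.
Qed.

Lemma meanZ t c f : mean t (fun h => c * f h) = c * mean t f.
Proof.
elim: t f => //= t IH f; rewrite -IH; apply: eq_mean => h _.
by rewrite mulr_sumr; apply: eq_bigr => x _; rewrite mulrCA.
Qed.

Lemma mean_cst t c : mean t (fun=> c) = c.
Proof.
elim: t => //= t IH; rewrite -[RHS]IH; apply: eq_mean => h _.
by rewrite -mulr_suml sum_step mul1r.
Qed.

Lemma mean_words t f : mean t f = \sum_(h <- words t) law h * f h.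
Proof.
elim: t f => [|t IH] f /=; first by rewrite big_seq1 mul1r.
rewrite IH big_allpairs_dep /=; apply: eq_bigr => h _.
rewrite mulr_sumr big_enum /=; apply: eq_bigr => x _; by rewrite mulrA.
Qed.

Lemma mem_words h : h \in words (size h).
Proof.
elim: h => //= x h IH; apply/allpairsPdep; exists h, x; split=> //.
by rewrite mem_enum.
Qed.

Lemma size_words t h : h \in words t -> size h = t.
Proof.
elim: t h => [|t IH] h /=; first by rewrite inE => /eqP->.
by move=> /allpairsPdep[h' [x [/IH <- _ ->]]].
Qed.

Lemma mean_point h (c : R) : mean (size h) (fun h' => (h' == h)%:R * c) = law h * c.
Proof.
elim: h c => [//|x h IH] c /=.
rewrite -mulrA -IH; apply: eq_mean => h' _.
rewrite (bigD1 x)//= eqseq_cons eqxx /= big1 ?addr0.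
  by case: eqP => [->|_]; rewrite ?mul1r// !mul0r mulr0.
by move=> y /negPf yx; rewrite eqseq_cons yx /= mul0r mulr0.
Qed.

(** * Martingale noise and maximal inequality *)

Definition noise (a : seq draw -> 'I_n -> R) h x : R :=
  \sum_i a h i * ((x.2 == i)%:R - colour_prob h i).

(** A martingale transform. Coefficients [a h j = (j == i)] give the accumulated noise of the
    proportion of colour [i]; [a = gain] gives its first-order effect on the Lyapunov function. *)
Fixpoint mart (a : seq draw -> 'I_n -> R) h : R :=
  if h is x :: h' then mart a h' + step_size n (size h') * noise a h' x else 0.

Lemma noise_mean0 a h : \sum_x step_prob h x * noise a h x = 0.
Proof.
rewrite (sum_step_colour h (fun j => \sum_i a h i * ((j == i)%:R - colour_prob h i))).
under eq_bigr do rewrite mulr_sumr.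
rewrite exchange_big /= big1// => i _.
transitivity (a h i * (\sum_j colour_prob h j * ((j == i)%:R - colour_prob h i))).
  by rewrite mulr_sumr; apply: eq_bigr => j _; rewrite mulrCA.
by rewrite sum_colour_prob_centered subrr mulr0.
Qed.

Lemma noise_le a h x c : (forall i, `|a h i| <= c) -> `|noise a h x| <= n%:R * c.
Proof.
move=> H; apply: le_trans (ler_norm_sum _ _ _) _.
apply: (@le_trans _ _ (\sum_(i < n) c)); last by rewrite sumr_const card_ord -[leLHS]mulr_natl.
apply: ler_sum => i _; rewrite normrM; apply: le_trans (H i); rewrite ler_piMr// ler_norml.
have := colour_prob_ge0 h i; have := colour_prob_le1 h i.
by case: eqP => _; rewrite /= => h1 h2; apply/andP; split; lra.
Qed.

(** Increments are orthogonal, as the cross term averages to 0 by [noise_mean0], and each is at most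
    [n * c * step_size]; the squared steps telescope. *)
Lemma mart_second_moment a c m t : (0 <= c) -> (forall h i, `|a h i| <= c) ->
  (forall h i, (size h < m)%N -> a h i = 0) ->
  mean t (fun h => mart a h ^+ 2) <= (n%:R * c) ^+ 2 * (m + n)%:R^-1.
Proof.
move=> c0 ac am.
(* With [maxn m t] the bound stays at 0 up to time [m], while the coefficients vanish, and
   telescopes afterwards. *)
suff H : mean t (fun h => mart a h ^+ 2) <=
    (n%:R * c) ^+ 2 * ((m + n)%:R^-1 - (maxn m t + n)%:R^-1).
  apply: le_trans H _; rewrite ler_wpM2l ?sqr_ge0// gerBl invr_ge0//.
elim: t => [|t IH]; first by rewrite /= expr0n maxn0 subrr mulr0.
apply: (@le_trans _ _ (mean t (fun h => mart a h ^+ 2) +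
   (n%:R * c) ^+ 2 * ((maxn m t + n)%:R^-1 - (maxn m t.+1 + n)%:R^-1))); last first.
  by apply: le_trans (lerD IH (lexx _)) _; rewrite -mulrDr addrA subrK.
rewrite -[X in _ + X](mean_cst t) -meanD /=; apply: le_mean => h ht.
apply: (@le_trans _ _ (\sum_x step_prob h x * (mart a h ^+ 2 +
   (2 * mart a h * step_size n t) * noise a h x +
   (n%:R * c) ^+ 2 * ((maxn m t + n)%:R^-1 - (maxn m t.+1 + n)%:R^-1)))); last first.
  under eq_bigr do rewrite 2!mulrDr.
  rewrite !big_split /= -!mulr_suml sum_step !mul1r.
  rewrite (eq_bigr (fun x => (2 * mart a h * step_size n t) * (step_prob h x * noise a h x))).
    by rewrite -mulr_sumr noise_mean0 mulr0 addr0.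
  by move=> x _; rewrite mulrCA.
apply: ler_sum => x _; rewrite ler_wpM2l ?step_prob_ge0//= ht sqrrD.
have -> : mart a h * (step_size n t * noise a h x) *+ 2 = 2 * mart a h * step_size n t * noise a h x by ring.
rewrite lerD2l exprMn.
have [tm|mt] := ltnP t m.
  have -> : noise a h x = 0 by rewrite /noise big1// => i _; rewrite am ?ht// mul0r.
  by rewrite expr0n /= mulr0 (maxn_idPl tm) subrr mulr0.
rewrite (maxn_idPr (leqW mt)) mulrC; apply: ler_pM; rewrite ?sqr_ge0//.
  rewrite -[leLHS]real_normK ?num_real// ler_pXn2r ?nnegrE ?mulr_ge0//.
  by apply: noise_le => i; exact: ac.
exact: step_size_sqr_le.
Qed.

(* Kolmogorov's inequality: freezing the martingale once it exceeds [d] keeps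
   its increments bounded, so the second moment bound still applies. *)
Section Maximal.
Variables (a : seq draw -> 'I_n -> R) (c d : R) (m : nat).
Hypotheses (c0 : 0 <= c) (ac : forall h i, `|a h i| <= c) (d0 : 0 < d).

Definition late h i : R := if (size h < m)%N then 0 else a h i.

Fixpoint exceeded h : bool :=
  (d < `|mart late h|) || (if h is x :: h' then exceeded h' else false).

Lemma mart_exceeded h : d < `|mart late h| -> exceeded h.
Proof. by case: h => [|x h] /= ->. Qed.

Definition stopped h i : R := if exceeded h then 0 else late h i.

Lemma mart_stopped h :
  if exceeded h then is_true (d < `|mart stopped h|) else mart stopped h = mart late h.
Proof.
elim: h => [|x h IH].
  by rewrite /= normr0 orbF ltNge ltW.
have noise0 : exceeded h -> noise stopped h x = 0.
  by move=> E; rewrite /noise big1// => i _; rewrite /stopped E mul0r.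
have noise1 : ~~ exceeded h -> noise stopped h x = noise late h x.
  by move=> /negPf E; apply: eq_bigr => i _; rewrite /stopped E.
rewrite /=; case: ifP IH noise0 noise1 => E IH noise0 noise1.
  by rewrite orbT noise0// mulr0 addr0.
by rewrite orbF IH noise1//; case: ifP.
Qed.

(** Chebyshev's inequality: by [mart_stopped], that the path has ever exceeded [d] can be read off
    the final value of the stopped martingale. *)
Lemma mean_exceeded t :
  mean t (fun h => (exceeded h)%:R) <= (n%:R * c) ^+ 2 / d ^+ 2 * (m + n)%:R^-1.
Proof.
rewrite mulrAC ler_pdivlMr ?exprn_gt0// mulrC -meanZ.
apply: le_trans (mart_second_moment (a := stopped) (m := m) t c0 _ _).
- apply: le_mean => h _; have := mart_stopped h; case: exceeded => [H|_]; rewrite ?mulr1 ?mulr0 ?sqr_ge0//.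
  by rewrite -[leRHS]real_normK ?num_real// ler_pXn2r ?nnegrE ?(ltW d0)// ltW.
- by move=> h i; rewrite /stopped /late; case: ifP => _; rewrite ?normr0//; case: ifP; rewrite ?normr0.
- by move=> h i hm; rewrite /stopped /late hm; case: ifP.
Qed.

End Maximal.

(* As long as [G < r], [G] is a supermartingale up to a summable error; on
   leaving [G < r] the stopped process takes the value [r]. *)
Section Confinement.
Variables (h0 : seq draw) (G : seq draw -> R) (r W : R).
Hypotheses (W0 : 0 <= W) (G_ge0 : forall h, 0 <= G h).
Hypothesis G_step : forall h, (size h0 <= size h)%N -> G h < r ->
  \sum_x step_prob h x * G (x :: h) <= G h + W * step_size n (size h) ^+ 2.

(** Recent draws come first, so [h0] being a suffix of [h] means that [h] continues [h0]. *)
Fixpoint from h : bool := (h == h0) || (if h is _ :: h' then from h' else false).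

Fixpoint stay h : bool :=
  (G h < r) && ((h == h0) || (if h is _ :: h' then stay h' else false)).

Lemma from_small h : (size h < size h0)%N -> from h = false.
Proof.
elim: h => [|x h IH] /= hs; first by rewrite orbF; apply/eqP => E; rewrite -E in hs.
rewrite IH ?(ltnW hs)// orbF; apply/eqP => E; rewrite -E /= in hs.
by rewrite ltnn in hs.
Qed.

Lemma from_size h : size h = size h0 -> from h = (h == h0).
Proof.
case: h => [|x h] hs /=; first by rewrite orbF.
by rewrite from_small ?orbF// -hs.
Qed.

Lemma stay_from h : stay h -> from h.
Proof.
elim: h => [|x h IH] /= /andP[_] //.
by case/orP => [->//|/IH ->]; rewrite orbT.
Qed.

Lemma stay_lt h : stay h -> G h < r.
Proof. by case: h => [|x h] /= /andP[]. Qed.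

Lemma escape_cons x h : from h && ~~ stay h -> from (x :: h) && ~~ stay (x :: h).
Proof.
move=> /andP[fh nsh]; have [hs|hs] := leqP (size h0) (size h); last first.
  by rewrite from_small in fh.
rewrite /= fh orbT (negbTE nsh) orbF /= negb_and orbC.
by case: eqP => // E; move: hs; rewrite -E /= ltnn.
Qed.

Let Phi h : R := if stay h then G h else if from h then r else 0.

Lemma Phi_step h : (size h0 <= size h)%N ->
  \sum_x step_prob h x * Phi (x :: h) <= Phi h + W * step_size n (size h) ^+ 2 * (from h)%:R.
Proof.
move=> hs.
have neq x : (x :: h == h0) = false.
  by apply/eqP => E; move: hs; rewrite -E /= ltnn.
have Wg : 0 <= W * step_size n (size h) ^+ 2 by rewrite mulr_ge0 ?sqr_ge0.
have := @stay_from h; rewrite /Phi; case E : (stay h) => F.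
  rewrite F// mulr1.
  have Gr : G h < r by apply: stay_lt.
  apply: le_trans (G_step hs Gr); apply: ler_sum => x _.
  (* Here [Phi (x :: h)] is the minimum of [G (x :: h)] and [r], so the overshoot at the exit does
     not enter. *)
  rewrite ler_wpM2l ?step_prob_ge0//= neq E F// orbT andbT.
  by case: ltP.
rewrite (eq_bigr (fun x => step_prob h x * (if from h then r else 0))); last first.
  by move=> x _; rewrite /= neq E andbF.
by rewrite -mulr_suml sum_step mul1r lerDl mulr_ge0.
Qed.

Lemma from_cons x h : (size h0 <= size h)%N -> from (x :: h) = from h.
Proof.
move=> hs /=; case: eqP => // E.
by move: hs; rewrite -E /= ltnn.
Qed.

Lemma mean_from t : (size h0 <= t)%N -> mean t (fun h => (from h)%:R) = law h0.
Proof.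
move=> /subnKC <-; elim: (_ - _)%N => [|k IH].
  rewrite addn0 -[RHS]mulr1 -mean_point; apply: eq_mean => h /from_size ->.
  by rewrite mulr1.
rewrite addnS -[RHS]IH /=; apply: eq_mean => h hk.
under eq_bigr do rewrite -/(from (_ :: h)) from_cons ?hk ?leq_addr//.
by rewrite -mulr_suml sum_step mul1r.
Qed.

(** In place of conditioning on the start [h0], [Phi] and the error terms vanish off the
    continuations of [h0], whence the factor [law h0]; the errors telescope. *)
Lemma mean_Phi t : (size h0 <= t)%N ->
  mean t Phi <= law h0 * (G h0 + W * ((size h0 + n)%:R^-1 - (t + n)%:R^-1)).
Proof.
move=> /subnKC <-; elim: (_ - _)%N => [|k IH].
  rewrite addn0 subrr mulr0 addr0 -mean_point; apply: le_mean => h hs.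
  rewrite /Phi; have := @stay_from h; rewrite from_size//.
  have [->|_] := eqVneq h h0; last by case: stay => [/(_ isT)//|_]; rewrite mul0r.
  rewrite mul1r => _.
  have -> : stay h0 = (G h0 < r).
    have : h0 == h0 := eqxx h0.
    by case: {1 3 4}h0 => [|x h'] /= ->; rewrite andbT.
  by case: ltP.
rewrite addnS.
apply: (@le_trans _ _ (mean (size h0 + k) (fun h => Phi h +
    (W * step_size n (size h0 + k) ^+ 2) * (from h)%:R))).
  rewrite [leLHS]/=; apply: le_mean => h hk; have := @Phi_step h; by rewrite hk leq_addr => /(_ isT).
rewrite meanD meanZ mean_from ?leq_addr//.
have := ler_wpM2l W0 (@step_size_sqr_le R n (size h0 + k) hn).
move=> /(ler_wpM2r (law_ge0 h0)).
by move: IH; lra.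
Qed.

(** Markov's inequality: [Phi] equals [r] on escaped histories and is nonnegative on the others. *)
Lemma mean_escape t : (size h0 <= t)%N ->
  mean t (fun h => (from h && ~~ stay h)%:R) * r
  <= law h0 * (G h0 + W * (size h0 + n)%:R^-1).
Proof.
move=> ht; rewrite mulrC -meanZ.
apply: le_trans (le_trans (mean_Phi ht) _).
  apply: le_mean => h _; rewrite /Phi.
  by case: stay; rewrite ?andbF ?mulr0// andbT; case: from; rewrite ?mulr1 ?mulr0.
rewrite ler_wpM2l ?law_ge0// lerD2l ler_wpM2l// gerBl invr_ge0//.
Qed.

End Confinement.

End Histories.

(** * From histories to trajectories *)

Lemma measure_nondecreasing_bigcup_le d (T : measurableType d) (R : realType)
    (mu : {measure set T -> \bar R}) (F : (set T)^nat) (c : \bar R) :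
  (forall t, measurable (F t)) -> (forall t, F t `<=` F t.+1) ->
  (forall t, (mu (F t) <= c)%E) -> (mu (\bigcup_t F t) <= c)%E.
Proof.
move=> mF ndF Fc.
have H : (mu \o F) x @[x --> \oo] --> mu (\bigcup_t F t).
  apply: nondecreasing_cvg_mu => //; first exact: bigcup_measurable.
  apply/nondecreasing_seqP => t; apply/subsetPset; exact: ndF.
rewrite -(cvg_lim _ H)//; apply: lime_le; first by apply/cvg_ex; eexists; exact: H.
by apply: nearW => t; exact: Fc.
Qed.

Section Trajectories.
Variables (R : realType) (n : nat) (alpha : R) (p : {set 'I_n} -> R).
Variables (d : measure_display) (T : measurableType d) (P : probability T R).
Variables (A : nat -> T -> {set 'I_n}) (C : nat -> T -> 'I_n)
  (N : nat -> 'I_n -> T -> nat).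
Hypotheses (hn : (0 < n)%N) (hp : is_subset_distr p) (hp0 : p finset.set0 = 0).
Hypothesis hW : is_WARM alpha p P A C N.

Fixpoint hist (t : nat) (w : T) : seq (draw n) :=
  if t is s.+1 then (A s.+1 w, C s.+1 w) :: hist s w else [::].

Lemma size_hist t w : size (hist t w) = t.
Proof. by elim: t => //= t ->. Qed.

Lemma count_hist t i w : N t i w = balls (hist t w) i.
Proof.
elim: t => [|t IH]; first by rewrite (count_init hW).
by rewrite (count_step hW)// IH /balls /= eq_sym addSn addnC.
Qed.

Lemma proportions_hist t w : proportions R N t w = fractions R (hist t w).
Proof. by apply/rowP => i; rewrite !mxE count_hist size_hist. Qed.

Lemma past_eventsI t E F : past_events A N t E -> past_events A N t F ->
  past_events A N t (E `&` F).
Proof. exact: (@measurableI _ (g_sigma_algebraType _)). Qed.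

Lemma sub_past_events s t E : (s <= t)%N -> past_events A N s E -> past_events A N t E.
Proof.
move=> st; apply: smallest_sub; first exact: smallest_sigma_algebra.
move=> F HF; apply: sub_gen_smallest.
case: HF => [[r [Y [r0 rs ->]]]|[r [i [Y [rs ->]]]]].
- by left; exists r, Y; split=> //; exact: leq_trans rs st.
- by right; exists r, i, Y; split=> //; exact: leq_trans rs st.
Qed.

Lemma past_events_measurable t E : past_events A N t E -> measurable E.
Proof.
apply: smallest_sub; first exact: sigma_algebra_measurable.
move=> F [[r [Y [r0 rs ->]]]|[r [i [Y [rs ->]]]]].
- exact: (subset_measurable hW).
- exact: (count_measurable hW).
Qed.

(** The past is generated by subsets and ball counts, not by colours; the colour drawn is recovered
    as the one whose count has increased. *)
Lemma past_events_hist t h : past_events A N t.+1 [set w | hist t w = h].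
Proof.
elim: t h => [|t IH] [|x h].
- rewrite (_ : [set _ | _] = setT); first exact: (@measurableT _ (g_sigma_algebraType _)).
  by apply/seteqP; split.
- rewrite (_ : [set _ | _] = set0); first exact: (@measurable0 _ (g_sigma_algebraType _)).
  by apply/seteqP; split.
- rewrite (_ : [set _ | _] = set0); first exact: (@measurable0 _ (g_sigma_algebraType _)).
  by apply/seteqP; split.
rewrite (_ : [set _ | _] = [set w | hist t w = h] `&`
   (A t.+1 @^-1` [set x.1] `&` N t.+1 x.2 @^-1` [set balls (x :: h) x.2])); last first.
  apply/seteqP; split=> [w /= [<- <-]|w /= [<- [e1]]].
    by split=> //; split=> //=; rewrite count_hist.
  rewrite count_hist /balls /= eqxx => -[H].
  have [e2|ne] := eqVneq (C t.+1 w) x.2; first by rewrite [in RHS](surjective_pairing x) e1 e2.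
  by move: H; rewrite (negbTE ne) add0n => /n_Sn.
apply: past_eventsI; first exact: sub_past_events (IH h).
apply: past_eventsI; apply: sub_gen_smallest.
  by left; exists t.+1, [set x.1].
by right; exists t.+1, x.2, [set balls (x :: h) x.2].
Qed.

Lemma measurable_hist_eq t h : measurable [set w | hist t w = h].
Proof. exact: past_events_measurable (@past_events_hist t h). Qed.

(** On the event that the history is [h] and the next subset is given, the conditional colour
    probability is constant; independence of the subset from the past supplies the factor [p]. *)
Lemma law_hist h : P [set w | hist (size h) w = h] = (law alpha p h)%:E.
Proof.
elim: h => [|x h IH] /=.
  by rewrite (_ : [set _ | _] = setT) ?probability_setT//; apply/seteqP; split.
pose E := [set w | hist (size h) w = h]; set t := (size h).+1.
have pE : past_events A N t E by exact: past_events_hist.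
have -> : [set w | (A t w, C t w) :: hist (size h) w = x :: h] =
    (E `&` A t @^-1` [set x.1]) `&` C t @^-1` [set x.2].
  apply/seteqP; split=> [w /= [<- eh]|w /= [[Ew e1] e2]]; first by [].
  by rewrite e1 e2 Ew -surjective_pairing.
have mEA : measurable (E `&` A t @^-1` [set x.1]).
  by apply: measurableI; [exact: past_events_measurable pE|exact: (subset_measurable hW)].
rewrite (colour_cond_law hW)//; last first.
  apply: (@measurableI _ (g_sigma_algebraType _)).
    by apply: sub_gen_smallest; left.
  by apply: sub_gen_smallest; right; exists [set x.1].
rewrite (eq_integral (cst (selection_prob alpha (balls h) x.1 x.2)%:E)); last first.
  move=> w; rewrite inE => -[/= Ew ->]; congr (selection_prob _ _ _ _)%:E.
  by apply/funext => j; rewrite count_hist Ew.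
transitivity ((selection_prob alpha (balls h) x.1 x.2)%:E * P (E `&` A t @^-1` [set x.1]))%E.
  exact: integral_cst.
rewrite (subset_indep_past hW)// (subset_law hW)// IH -!EFinM.
by congr EFin; rewrite /step_prob mulrC mulrA.
Qed.

Lemma measurable_hist t (Y : pred (seq (draw n))) : measurable [set w | Y (hist t w)].
Proof.
rewrite (_ : [set _ | _] = \bigcup_(h in [set` [seq h <- words n t | Y h]]) [set w | hist t w = h]).
  apply: fin_bigcup_measurable; first exact: finite_seq.
  by move=> h _; exact: measurable_hist_eq.
apply/seteqP; split=> [w /= Yw|w [h /=]].
  by exists (hist t w) => //=; rewrite mem_filter Yw -{2}(size_hist t w) mem_words.
by rewrite mem_filter => /andP[Yh _] ->.
Qed.

Lemma prob_hist_le t (Y : pred (seq (draw n))) :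
  (P [set w | Y (hist t w)] <= (mean alpha p t (fun h => (Y h)%:R))%:E)%E.
Proof.
have H (ws : seq (seq (draw n))) : (forall h, h \in ws -> size h = t) ->
   (P [set w | hist t w \in ws] <= (\sum_(h <- ws) law alpha p h)%:E)%E.
  elim: ws => [|h ws IH] Hs.
    rewrite big_nil (_ : [set _ | _] = set0) ?measure0//; by apply/seteqP; split.
  rewrite big_cons (_ : [set _ | _] = [set w | hist t w = h] `|` [set w | hist t w \in ws]); last first.
    apply/seteqP; split=> w /=; rewrite inE; first by case/orP => [/eqP|]; [left|right].
    by case=> [->|->]; rewrite ?eqxx ?orbT.
  apply: (@le_trans _ _ (P [set w | hist t w = h] + P [set w | hist t w \in ws])%E).
    by apply: measureU2; [exact: measurable_hist_eq|exact: (measurable_hist t (mem ws))].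
  rewrite EFinD leeD//.
    by rewrite -{1}(Hs h) ?inE ?eqxx// law_hist.
  by apply: IH => h' h'w; apply: Hs; rewrite inE h'w orbT.
rewrite mean_words.
have -> : \sum_(h <- words n t) law alpha p h * (Y h)%:R =
   \sum_(h <- [seq h <- words n t | Y h]) law alpha p h.
  rewrite big_filter [RHS]big_mkcond /=; apply: eq_bigr => h _.
  by case: (Y h); rewrite ?mulr1 ?mulr0.
apply: le_trans (H _ _); last by move=> h; rewrite mem_filter => /andP[_ /size_words].
rewrite le_measure ?inE//.
- exact: measurable_hist.
- exact: (measurable_hist t (mem [seq h <- words n t | Y h])).
- by move=> w /= Yw; rewrite mem_filter Yw -{2}(size_hist t w) mem_words.
Qed.

Lemma mart_late (a : seq (draw n) -> 'I_n -> R) m t w : (m <= t)%N ->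
  mart alpha p (late a m) (hist t w) = mart alpha p a (hist t w) - mart alpha p a (hist m w).
Proof.
move=> /subnKC <-; elim: (t - m)%N => [|k IH].
  rewrite addn0 subrr.
  have : forall s, (s <= m)%N -> mart alpha p (late a m) (hist s w) = 0; last by apply.
  elim=> //= s IH sm; rewrite IH ?(ltnW sm)// size_hist /noise big1 ?mulr0 ?addr0// => i _.
  by rewrite /late size_hist sm mul0r.
rewrite addnS /= IH size_hist addrAC; congr (_ + _ * _ - _).
apply: eq_bigr => i _; by rewrite /late size_hist ltnNge leq_addr.
Qed.

(** A fluctuation above [1/(k+1)] after time [m] has probability of order [1/(m+n)], so having one
    after every [m] is a null event; countably many thresholds [k] suffice. *)
Lemma mart_ae_cauchy (a : seq (draw n) -> 'I_n -> R) c : 0 <= c ->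
  (forall h i, `|a h i| <= c) ->
  {ae P, forall w, forall e, 0 < e -> exists m, forall s, (m <= s)%N ->
    `|mart alpha p a (hist s w) - mart alpha p a (hist m w)| <= e}.
Proof.
move=> c0 ac.
pose del k : R := k.+1%:R^-1.
have del0 k : 0 < del k by rewrite invr_gt0 ltr0n.
pose bad k m := \bigcup_t [set w | exceeded alpha p a (del k) m (hist t w)].
have mbad k m : measurable (bad k m).
  by apply: bigcup_measurable => t _; exact: measurable_hist.
have Pbad k m : (P (bad k m) <= ((n%:R * c) ^+ 2 / del k ^+ 2 * (m + n)%:R^-1)%:E)%E.
  apply: measure_nondecreasing_bigcup_le.
  - by move=> t; exact: measurable_hist.
  - by move=> t w /= ->; rewrite orbT.
  - move=> t; apply: le_trans (prob_hist_le _ _) _; rewrite lee_fin.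
    exact: mean_exceeded.
have nbad k : P (\bigcap_m bad k m) = 0%E.
  apply/eqP; rewrite eq_le measure_ge0 andbT; apply/lee_addgt0Pr => e e0; rewrite add0e.
  pose K := (n%:R * c) ^+ 2 / del k ^+ 2.
  have K0 : 0 <= K by rewrite divr_ge0 ?sqr_ge0.
  pose m := Num.bound (K / e).
  apply: (@le_trans _ _ (P (bad k m))).
    rewrite le_measure ?inE//; first exact: bigcap_measurable.
    by apply: bigcap_inf.
  apply: le_trans (Pbad k m) _; rewrite lee_fin -/K.
  have mn0 : 0 < (m + n)%:R :> R by rewrite ltr0n addn_gt0 hn orbT.
  rewrite ler_pdivrMr// mulrC -ler_pdivrMr//.
  apply: (@le_trans _ _ m%:R); last by rewrite ler_nat leq_addr.
  by apply/ltW/archi_boundP; rewrite divr_ge0// ltW.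
apply: (@negligibleS _ _ _ _ (\bigcup_k \bigcap_m bad k m)); last first.
  apply: negligible_bigcup => k; exists (\bigcap_m bad k m).
  by split; [exact: bigcapT_measurable|exact: nbad|].
move=> w /= Hw; apply: contrapT => nbw; apply: Hw => e e0.
pose k := Num.bound e^-1.
have ke : del k <= e.
  rewrite /del -[leRHS]invrK lef_pV2 ?posrE ?invr_gt0 ?ltr0n//.
  apply: (@le_trans _ _ k%:R); last by rewrite ler_nat.
  by apply/ltW/archi_boundP; rewrite invr_ge0 ltW.
have [m Hm] : exists m, ~ bad k m w.
  apply: contrapT => Hn; apply: nbw; exists k => // m _.
  by apply: contrapT => Hm; apply: Hn; exists m.
exists m => s ms; rewrite -mart_late//; apply: le_trans ke; rewrite leNgt; apply/negP => H.
by apply: Hm; exists s => //; exact: mart_exceeded.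
Qed.

End Trajectories.

(** * Almost sure behaviour of the urn *)

Section AlmostSureLimitSet.
Variables (R : realType) (n : nat) (alpha : R) (p : {set 'I_n} -> R).
Variables (d : measure_display) (T : measurableType d) (P : probability T R).
Variables (A : nat -> T -> {set 'I_n}) (C : nat -> T -> 'I_n)
  (N : nat -> 'I_n -> T -> nat).
Hypotheses (hn : (0 < n)%N) (halpha : 1 < alpha).
Hypotheses (hp : is_subset_distr p) (hp0 : p finset.set0 = 0).
Hypothesis hW : is_WARM alpha p P A C N.

Lemma ae_drift_vanishes :
  {ae P, forall w, forall e, 0 < e -> exists t0, forall t, (t0 <= t)%N ->
    core p (proportions R N t w) /\ `|drift alpha p (proportions R N t w)| < e}.
Proof.
pose ac (i : 'I_n) (h : seq (draw n)) (j : 'I_n) : R := (j == i)%:R.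
(* The gain is bounded only on [core]. Cutting it off outside makes the coefficients bounded, and
   the trajectory eventually remains in [core]. *)
pose aL (h : seq (draw n)) (i : 'I_n) : R :=
  if `[< core p (fractions R h) >] then gain alpha p (fractions R h) i else 0.
have p_ge0 B : 0 <= p B by case: hp.
have hU : \forall w \ae P, forall i : 'I_n, forall e, 0 < e -> exists m, forall s, (m <= s)%N ->
    `|mart alpha p (ac i) (hist A C s w) - mart alpha p (ac i) (hist A C m w)| <= e.
  apply: filter_forall => i; apply: (mart_ae_cauchy hn hp hp0 hW ler01) => h j.
  by rewrite /ac ger0_norm// lern1 leq_b1.
have G0 : 0 <= gain_ub alpha p.
  by apply: sumr_ge0 => B _; rewrite divr_ge0// powR_ge0.
have hV : \forall w \ae P, forall e, 0 < e -> exists m, forall s, (m <= s)%N ->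
    `|mart alpha p aL (hist A C s w) - mart alpha p aL (hist A C m w)| <= e.
  apply: (mart_ae_cauchy hn hp hp0 hW G0) => h j; rewrite /aL.
  case: asboolP => [ch|_]; last by rewrite normr0.
  by rewrite ger0_norm; [exact: gain_le|exact: gain_ge0].
apply: filterS2 hU hV => w Uc Vc.
suff H : forall e, 0 < e -> exists t0, forall t, (t0 <= t)%N ->
    core p (fractions R (hist A C t w)) /\ `|drift alpha p (fractions R (hist A C t w))| < e.
  by move=> e /H[t0 Ht]; exists t0 => t /Ht; rewrite (proportions_hist hW).
pose U t : 'rV[R]_n := \row_i mart alpha p (ac i) (hist A C t w).
have U_step t i : (U t.+1 - U t) 0 i = step_size n t * ((C t.+1 w == i)%:R - colour_prob alpha p (hist A C t w) i).
  rewrite !mxE /= size_hist addrAC subrr add0r; congr (_ * _).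
  rewrite /noise (bigD1 i)//= big1 ?addr0 /ac ?eqxx ?mul1r//.
  by move=> j /negPf ->; rewrite mul0r.
apply: (@drift_vanishes R n alpha p hn halpha hp hp0 (fun t => fractions R (hist A C t w)) U
   (fun t => mart alpha p aL (hist A C t w))).
- by move=> t; exact: fractions_simplex.
- by move=> t i; exact: fractions_gt0.
- have entryE (X F D : 'rV[R]_n) c i : (X + c *: F + D) 0 i = X 0 i + c * F 0 i + D 0 i.
    by rewrite !mxE.
  move=> t; apply/rowP => i.
  by rewrite entryE U_step colour_prob_drift// fractions_cons// size_hist /=; ring.
- by move=> t; have := fractions_incr R hn (A t.+1 w, C t.+1 w) (hist A C t w); rewrite size_hist.
- move=> t ct; rewrite /= addrAC subrr add0r size_hist /noise mulr_sumr.
  apply: eq_bigr => i _; rewrite U_step /aL asboolT//; ring.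
- move=> e e0; have e20 : 0 < e / 2 by rewrite divr_gt0.
  have [f Hf] := choice (fun i => Uc i _ e20).
  exists (\max_i f i) => s ms; apply: norm_rV_le; first exact: ltW.
  move=> i; have fi : (f i <= \max_i f i)%N := leq_bigmax i.
  have := Hf i _ fi; have := Hf i _ (leq_trans fi ms).
  rewrite !mxE; set a := mart _ _ _ _; set b := mart _ _ _ _; set c := mart _ _ _ _.
  by rewrite !ler_norml => /andP[h1 h2] /andP[h3 h4]; apply/andP; split; lra.
- exact: Vc.
Qed.

Lemma proportions_simplex t w : simplex R n (proportions R N t w).
Proof. by rewrite (proportions_hist hW); exact: fractions_simplex. Qed.

Lemma simplex_norm_le1 (x : 'rV[R]_n) : simplex R n x -> `|x| <= 1.
Proof.
move=> sx; apply: norm_rV_le => // i; have /andP[x0 x1] := simplex_le1 i sx.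
by rewrite ger0_norm.
Qed.

Lemma proportions_cluster_connected w : connected (accumulation_points R N w).
Proof.
apply: (@connected_cluster _ _ _ 1).
  by move=> t; apply: simplex_norm_le1; exact: proportions_simplex.
move=> e e0; exists (Num.bound e^-1) => t Tt.
rewrite !(proportions_hist hW).
apply: le_lt_trans (fractions_incr R hn (A t.+1 w, C t.+1 w) (hist A C t w)) _.
rewrite size_hist /step_size -[ltRHS]invrK ltf_pV2 ?posrE ?invr_gt0 ?ltr0n//.
apply: (@lt_le_trans _ _ (Num.bound e^-1)%:R).
  by apply: archi_boundP; rewrite invr_ge0 ltW.
by rewrite ler_nat (leq_trans Tt)// (leq_trans (leqnSn t))// leq_addr.
Qed.

End AlmostSureLimitSet.

(** * Symmetrizable matrices *)

Section RayleighQuotient.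
Variables (R : realType) (n : nat).
Implicit Types (M : 'M[R]_n) (y z : 'rV[R]_n).

Definition qform M y : R := (y *m M *m y^T) 0 0.

Lemma qformE M y : qform M y = \sum_i y 0 i * \sum_k M i k * y 0 k.
Proof.
rewrite /qform -mulmxA mxE; apply: eq_bigr => i _; rewrite mxE; congr (_ * _).
by apply: eq_bigr => k _; rewrite mxE.
Qed.

Lemma qformZ M c y : qform M (c *: y) = c ^+ 2 * qform M y.
Proof. by rewrite /qform linearZ /= -!scalemxAl -scalemxAr !mxE mulrA expr2. Qed.

Lemma qformB M N y : qform (M - N) y = qform M y - qform N y.
Proof. by rewrite /qform mulmxBr mulmxBl !mxE. Qed.

Lemma qform_scale c M y : qform (c *: M) y = c * qform M y.
Proof. by rewrite /qform -scalemxAr -scalemxAl mxE. Qed.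

Lemma qformD M y z : M^T = M ->
  qform M (y + z) = qform M y + (y *m M *m z^T) 0 0 *+ 2 + qform M z.
Proof.
move=> sM; have E : (z *m M *m y^T) 0 0 = (y *m M *m z^T) 0 0.
  by rewrite -[z *m M *m y^T]trmxK mxE !trmx_mul trmxK sM mulmxA.
have addE (X Y : 'M[R]_1) : (X + Y) 0 0 = X 0 0 + Y 0 0 by rewrite mxE.
by rewrite /qform linearD /= !mulmxDl !mulmxDr !addE E; ring.
Qed.

Lemma psd_kernel M y : M^T = M -> (forall z, 0 <= qform M z) -> qform M y = 0 ->
  y *m M = 0.
Proof.
move=> sM psd y0; pose z := y *m M.
pose s := \sum_i z 0 i ^+ 2.
have zz : (y *m M *m z^T) 0 0 = s.
  by rewrite -/z mxE; apply: eq_bigr => i _; rewrite [z^T _ _]mxE expr2.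
have s0 : 0 <= s by apply: sumr_ge0 => i _; exact: sqr_ge0.
(* The form is evaluated at [y - t z] with [z = y M]: its part linear in [t] is [- 2 t s], which for
   small [t] would make it negative unless [s = 0]. *)
have H t : 0 < t -> 2 * s <= t * qform M z.
  move=> t0; have := psd (y + (- t) *: z).
  rewrite qformD// y0 add0r qformZ linearZ /= -scalemxAr mxE zz => h.
  rewrite -(ler_pM2l t0); move: h; rewrite -mulr_natl; nra.
have {}s0 : s = 0.
  apply/le_anti; rewrite s0 andbT leNgt; apply/negP => sp.
  have g0 : 0 < qform M z + 1 by have := psd z; lra.
  have t0 : 0 < s / (qform M z + 1) by rewrite divr_gt0.
  have := H _ t0; rewrite mulrAC.
  have : s * qform M z / (qform M z + 1) <= s.
    by rewrite ler_pdivrMr// ler_pM2l// lerDl.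
  lra.
apply/rowP => i; rewrite [RHS]mxE -/z; apply/eqP; rewrite -sqrf_eq0.
rewrite eq_le sqr_ge0 andbT -s0 /s (bigD1 i)//= lerDl.
by apply: sumr_ge0 => j _; exact: sqr_ge0.
Qed.

Lemma qform_continuous M : continuous (qform M).
Proof.
rewrite (_ : qform M = fun y => \sum_i y 0 i * \sum_k M i k * y 0 k); last first.
  by apply/funext => y; exact: qformE.
apply: continuous_big => [|i _]; first exact: add_continuous.
have inner : continuous (fun y : 'rV[R]_n => \sum_k M i k * y 0 k).
  apply: continuous_big => [|k _]; first exact: add_continuous.
  by move=> y; apply: continuousM; [exact: cst_continuous|exact: coord_continuous].
by move=> y; apply: continuousM; [exact: coord_continuous|exact: inner].
Qed.

(* A maximizer of the quadratic form of [D] on the unit sphere of the weighted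
   norm is an eigenvector, so the maximum is a real eigenvalue. *)
Lemma rayleigh_bound (D : 'M[R]_n) (w : 'I_n -> R) : (0 < n)%N ->
  (forall i, 0 < w i) -> (forall i k, w i * D i k = w k * D k i) ->
  (forall z : R[i], eigenvalue (map_mx (real_complex R) D) z -> complex.Re z < 0) ->
  exists2 c, 0 < c & forall y,
    \sum_i w i * y 0 i * (\sum_k D i k * y 0 k) <= - c * \sum_i w i * y 0 i ^+ 2.
Proof.
move=> n0 w0 sD neg.
pose W : 'M[R]_n := diag_mx (\row_i w i).
pose S : 'M[R]_n := W *m D.
have SE i k : S i k = w i * D i k.
  by rewrite /S mul_diag_mx !mxE.
have sS : S^T = S by apply/matrixP => i k; rewrite mxE !SE.
have sW : W^T = W by rewrite tr_diag_mx.
have qW y : qform W y = \sum_i w i * y 0 i ^+ 2.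
  rewrite qformE; apply: eq_bigr => i _; rewrite (bigD1 i)//= big1.
    by rewrite !mxE eqxx addr0 mulr1n; ring.
  by move=> k /negPf ki; rewrite !mxE eq_sym ki mulr0n mul0r.
have qS y : qform S y = \sum_i w i * y 0 i * (\sum_k D i k * y 0 k).
  rewrite qformE; apply: eq_bigr => i _; rewrite -mulrA mulrCA; congr (_ * _).
  by rewrite mulr_sumr; apply: eq_bigr => k _; rewrite SE mulrA.
have qW_ge0 y : 0 <= qform W y.
  by rewrite qW; apply: sumr_ge0 => i _; rewrite mulr_ge0 ?sqr_ge0 ?ltW.
have qW_eq0 y : qform W y = 0 -> y = 0.
  rewrite qW => /eqP; rewrite psumr_eq0; last by move=> i _; rewrite mulr_ge0 ?sqr_ge0 ?ltW.
  move=> /allP H; apply/rowP => i; rewrite mxE; apply/eqP.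
  have := H i (mem_index_enum i); rewrite mulf_eq0 sqrf_eq0 => /orP[|//].
  by rewrite gt_eqF.
have qW_gt0 y : y != 0 -> 0 < qform W y.
  by move=> y0; rewrite lt_neqAle qW_ge0 andbT eq_sym; apply: contra y0 => /eqP/qW_eq0 ->.
pose K : set 'rV[R]_n := [set y | qform W y = 1].
have normK y : y != 0 -> K ((Num.sqrt (qform W y))^-1 *: y).
  move=> /qW_gt0 h; rewrite /K /= qformZ exprVn sqr_sqrtr ?(ltW h)// mulVf// gt_eqF//.
have K0 : K !=set0.
  exists ((Num.sqrt (qform W (const_mx 1)))^-1 *: const_mx 1); apply: normK.
  apply/eqP => /rowP /(_ (Ordinal n0)); rewrite !mxE => /eqP; by rewrite oner_eq0.
have cK : compact K.
  apply: bounded_closed_compact.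
    exists (\sum_i (w i)^-1 + 1); split; first exact: num_real.
    move=> M ltM y Ky; apply: norm_rV_le.
      apply: ltW; apply: le_lt_trans ltM; rewrite addr_ge0// sumr_ge0// => i _.
      by rewrite invr_ge0 ltW.
    move=> i; have h1 : w i * y 0 i ^+ 2 <= 1.
      have <- : qform W y = 1 by [].
      rewrite qW (bigD1 i)//= lerDl sumr_ge0// => j _.
      by rewrite mulr_ge0 ?sqr_ge0 ?ltW.
    have h2 : (w i)^-1 <= \sum_i (w i)^-1.
      by rewrite (bigD1 i)//= lerDl sumr_ge0// => j _; rewrite invr_ge0 ltW.
    have h3 : `|y 0 i| ^+ 2 <= (w i)^-1.
      by rewrite real_normK ?num_real// -[leRHS]mul1r ler_pdivlMr// mulrC.
    have := sqr_ge0 (`|y 0 i| - 1); have := sqr_ge0 `|y 0 i|.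
    by rewrite sqrrB1; lra.
  have -> : K = qform W @^-1` [set 1] by [].
  apply: preimage_closed; first by move=> y _; exact: qform_continuous.
  exact: closed_eq.
have [y0 Ky0 ymax] := compact_EVT_max K0 cK (continuous_subspaceT (@qform_continuous S)).
rewrite inE in Ky0; pose mu := qform S y0.
have ub y : qform S y <= mu * qform W y.
  have [->|ny0] := eqVneq y 0.
    by rewrite /qform !mul0mx !mxE mulr0.
  have := ymax ((Num.sqrt (qform W y))^-1 *: y); rewrite inE => /(_ (normK y ny0)).
  have h := qW_gt0 y ny0.
  by rewrite qformZ exprVn sqr_sqrtr ?(ltW h)// mulrC ler_pdivrMr.
(* Maximality says that [mu W - S] is positive semidefinite and its form vanishes at [y0], so [y0]
   lies in its kernel. *)
have ker : y0 *m (mu *: W - S) = 0.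
  apply: psd_kernel.
  - by rewrite linearB /= linearZ /= sW sS.
  - by move=> z; rewrite qformB qform_scale subr_ge0.
  - have -> : qform (mu *: W - S) y0 = mu * 1 - mu by rewrite qformB qform_scale Ky0.
    by rewrite mulr1 subrr.
have y0n0 : y0 *m W != 0.
  apply/eqP => E; have : qform W y0 = 1 by [].
  by rewrite /qform E mul0mx mxE => /esym/eqP; rewrite oner_eq0.
have mu_neg : mu < 0.
  (* Eigenvectors are row vectors acting from the left: [y0 S = mu y0 W] with [S = W D] makes [y0 W]
     an eigenvector of [D]. *)
  have : eigenvalue (map_mx (real_complex R) D) (real_complex R mu).
    apply/eigenvalueP; exists (map_mx (real_complex R) (y0 *m W)).
      rewrite -map_mxM -mulmxA -/S -map_mxZ; congr map_mx.
      move/eqP: ker; rewrite mulmxBr subr_eq0 => /eqP <-.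
      by rewrite -scalemxAr.
    by rewrite map_mx_eq0.
  by move/neg.
exists (- mu); first by rewrite oppr_gt0.
by move=> y; rewrite opprK -qS -qW.
Qed.

End RayleighQuotient.

(** * The Jacobian at an equilibrium *)

Section FirstOrderExpansion.
Variables (R : realType) (n : nat) (v : 'rV[R]_n).
Hypothesis v0 : forall i, 0 <= v 0 i.
Implicit Types (f g l : 'rV[R]_n -> R).

(* One-sided differentiability at [v] relative to the closed orthant: [v] may
   lie on its boundary, and [powR] is not continuous across it. *)
Definition expands f l : Prop :=
  (exists K, forall y, `|l y| <= K * `|y|) /\
  forall e : R, 0 < e -> nbhs v [set x : 'rV[R]_n |
    (forall i, 0 <= x 0 i) -> `|f x - f v - l (x - v)| <= e * `|x - v|].

Lemma eq_expands f l l' : (forall y, l y = l' y) -> expands f l -> expands f l'.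
Proof.
by move=> E; have -> : l' = l by apply/funext => y; rewrite E.
Qed.

Lemma expands0 : expands (fun=> 0) (fun=> 0).
Proof.
split; first by exists 0 => y; rewrite normr0 mul0r.
by move=> e e0; apply: (@filterE _ (nbhs v)) => x _; rewrite !subrr normr0 mulr_ge0// ltW.
Qed.

Lemma expands_coord i : expands (fun x => x 0 i) (fun y => y 0 i).
Proof.
split; first by exists 1 => y; rewrite mul1r; exact: ler_coord_norm.
by move=> e e0; apply: (@filterE _ (nbhs v)) => x _; rewrite !mxE subrr normr0 mulr_ge0// ltW.
Qed.

Lemma expandsD f g l m : expands f l -> expands g m ->
  expands (fun x => f x + g x) (fun y => l y + m y).
Proof.
move=> [[K HK] fl] [[L HL] gm]; split.
  exists (K + L) => y; apply: le_trans (ler_normD _ _) _.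
  by rewrite mulrDl lerD.
move=> e e0; have e20 : 0 < e / 2 by rewrite divr_gt0.
apply: filterS2 (fl _ e20) (gm _ e20) => x + + x0 => /(_ x0) h1 /(_ x0) h2.
have -> : f x + g x - (f v + g v) - (l (x - v) + m (x - v)) =
  (f x - f v - l (x - v)) + (g x - g v - m (x - v)) by ring.
apply: le_trans (ler_normD _ _) _; lra.
Qed.

Lemma expandsZ c f l : expands f l -> expands (fun x => c * f x) (fun y => c * l y).
Proof.
move=> [[K HK] fl]; split.
  by exists (`|c| * K) => y; rewrite normrM -mulrA ler_wpM2l.
move=> e e0; have c0 : 0 < `|c| + 1 by rewrite ltr_wpDl.
have ec : 0 < e / (`|c| + 1) by rewrite divr_gt0.
apply: filterS (fl _ ec) => x + x0 => /(_ x0) h.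
rewrite -!mulrBr normrM; apply: (@le_trans _ _ ((`|c| + 1) * (e / (`|c| + 1) * `|x - v|))).
  by apply: ler_pM => //; rewrite lerDl.
by rewrite mulrA mulrCA divff ?mulr1// gt_eqF.
Qed.

Lemma expands_sum (I : Type) (r : seq I) (Q : pred I) (f l : I -> 'rV[R]_n -> R) :
  (forall i, Q i -> expands (f i) (l i)) ->
  expands (fun x => \sum_(i <- r | Q i) f i x) (fun y => \sum_(i <- r | Q i) l i y).
Proof.
move=> H; elim: r => [|i r IH].
  have -> : (fun x => \sum_(i <- [::] | Q i) f i x) = fun=> 0.
    by apply/funext => x; rewrite big_nil.
  by apply: eq_expands expands0 => y; rewrite big_nil.
have -> : (fun x => \sum_(j <- i :: r | Q j) f j x) =
   (fun x => (if Q i then f i x else 0) + \sum_(j <- r | Q j) f j x).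
  by apply/funext => x; rewrite big_cons; case: (Q i); rewrite ?add0r.
apply: (@eq_expands _ (fun y => (if Q i then l i y else 0) + \sum_(j <- r | Q j) l j y)).
  by move=> y; rewrite big_cons; case: (Q i); rewrite ?add0r.
by apply: expandsD IH; case E : (Q i); [exact: H|exact: expands0].
Qed.

Lemma expands_powR alpha i : 1 < alpha ->
  expands (fun x => x 0 i `^ alpha) (fun y => alpha * v 0 i `^ (alpha - 1) * y 0 i).
Proof.
move=> ha; split.
  exists `|alpha * v 0 i `^ (alpha - 1)| => y.
  by rewrite normrM ler_wpM2l//; exact: ler_coord_norm.
move=> e e0; have [d d0 H] := powR_expand ha (v0 i) e0.
apply/nbhs_ballP; exists d => // x; rewrite -ball_normE /= distrC => xd x0.
have xvi : `|x 0 i - v 0 i| <= `|x - v|.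
  by have := ler_coord_norm (x - v) i; rewrite !mxE.
have -> : (x - v) 0 i = x 0 i - v 0 i by rewrite !mxE.
apply: le_trans (H _ (x0 i) (le_lt_trans xvi xd)) _.
by rewrite ler_wpM2l// ltW.
Qed.

Lemma expands_div f g l m : expands f l -> expands g m -> 0 < g v ->
  expands (fun x => f x / g x) (fun y => (l y * g v - f v * m y) / g v ^+ 2).
Proof.
move=> [[K HK] fl] [[L HL] gm] g0.
pose b := g v + `|f v|; have b0 : 0 < b by rewrite /b ltr_wpDr.
split.
  exists ((K * g v + `|f v| * L) / g v ^+ 2) => y.
  rewrite normrM normfV (ger0_norm (sqr_ge0 _)) mulrAC ler_wpM2r ?invr_ge0 ?sqr_ge0//.
  apply: le_trans (ler_normB _ _) _; rewrite !normrM (gtr0_norm g0) mulrDl lerD//.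
    by rewrite mulrAC ler_wpM2r// ltW.
  by rewrite -mulrA ler_wpM2l.
move=> e e0.
(* [M] is a Lipschitz constant at [v] for both [f] and [g]: slopes [K] and [L], plus 1 for the
   remainders, which is why [e1] is capped at 1. *)
pose M := `|K| + `|L| + 1; have M0 : 0 < M by rewrite ltr_wpDl// addr_ge0.
pose e1 := Num.min 1 (e / 2 * (g v ^+ 2 / b)).
have e10 : 0 < e1 by rewrite /e1 lt_min ltr01 mulr_gt0 ?divr_gt0 ?exprn_gt0.
(* The first bound keeps [g x] above [g v / 2]; the second makes the quadratic part of the remainder
   at most [e / 2 * N]. *)
pose d := Num.min (g v / 2 / M) (e / 2 * (g v ^+ 2 * (g v / 2)) / (b * M ^+ 2)).
have d0 : 0 < d.
  by rewrite /d lt_min !divr_gt0 ?mulr_gt0 ?divr_gt0 ?exprn_gt0.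
have near_d : nbhs v [set x | `|x - v| < d].
  by apply/nbhs_ballP; exists d => //= x; rewrite -ball_normE /= distrC.
apply: filterS3 near_d (fl _ e10) (gm _ e10) => x xd + + x0 => /(_ x0) h1 /(_ x0) h2.
set N := `|x - v| in xd h1 h2 *; have N0 : 0 <= N := normr_ge0 _.
have e1le : e1 <= 1 by rewrite /e1 ge_min lexx.
have DM (D k : R) (c : R) : `|D - k| <= e1 * N -> `|k| <= c * N -> c <= `|K| + `|L| -> `|D| <= M * N.
  move=> a1 a2 a3; have := ler_normD (D - k) k; rewrite subrK.
  by rewrite /M; nra.
have df : `|f x - f v| <= M * N.
  by apply: DM h1 (HK _) _; rewrite (le_trans (ler_norm K))// lerDl.
have dg : `|g x - g v| <= M * N.
  by apply: DM h2 (HL _) _; rewrite (le_trans (ler_norm L))// lerDr.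
have MN : M * N <= g v / 2.
  rewrite mulrC -ler_pdivlMr//; apply/ltW; apply: lt_le_trans xd _.
  by rewrite /d ge_min lexx.
have gx : g v / 2 <= g x.
  by move: dg; rewrite ler_norml => /andP[? _]; lra.
have gx0 : 0 < g x by lra.
set D := f x - f v in h1 df; set E := g x - g v in h2 dg.
set k := l (x - v) in h1 *; set j := m (x - v) in h2 *.
(* The remainder splits into the remainders of [f] and [g], of size [e1 * N], and a term quadratic
   in the increments. *)
have -> : f x / g x - f v / g v - (k * g v - f v * j) / g v ^+ 2 =
   ((D - k) * g v - f v * (E - j)) / g v ^+ 2
   - (D * g v - f v * E) * E / (g v ^+ 2 * g x).
  by rewrite /D /E; field; rewrite !gt_eqF.
have bound (p q c : R) : 0 <= c -> `|p| <= c -> `|q| <= c -> `|p * g v - f v * q| <= c * b.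
  move=> c0 pc qc; apply: le_trans (ler_normB _ _) _; rewrite !normrM (gtr0_norm g0) /b mulrDr lerD//.
    by rewrite ler_wpM2r// ltW.
  by rewrite mulrC ler_wpM2r.
have e1N : 0 <= e1 * N by rewrite mulr_ge0// ltW.
have MN0 : 0 <= M * N by rewrite mulr_ge0// ltW.
have B1 := bound _ _ _ e1N h1 h2.
have B2 := bound _ _ _ MN0 df dg.
have g20 : 0 < g v ^+ 2 by rewrite exprn_gt0.
apply: le_trans (ler_normB _ _) _.
have -> : e * N = e / 2 * N + e / 2 * N by rewrite -mulrDl -splitr.
apply: lerD.
  rewrite normrM normfV (gtr0_norm g20) ler_pdivrMr//; apply: le_trans B1 _.
  have : e1 * b <= e / 2 * g v ^+ 2.
    rewrite -ler_pdivlMr//; apply: (@le_trans _ _ (e / 2 * (g v ^+ 2 / b))); last by rewrite mulrA.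
    by rewrite /e1 ge_min lexx orbT.
  by move=> h; have := ler_wpM2r N0 h; lra.
rewrite normrM normfV (gtr0_norm (mulr_gt0 g20 gx0)) ler_pdivrMr ?mulr_gt0//.
rewrite normrM; apply: (@le_trans _ _ (M * N * b * (M * N))); first exact: ler_pM.
have h : N * (b * M ^+ 2) <= e / 2 * (g v ^+ 2 * (g v / 2)).
  rewrite -ler_pdivlMr ?mulr_gt0 ?exprn_gt0//; apply/ltW; apply: lt_le_trans xd _.
  by rewrite /d ge_min lexx orbT.
apply: (@le_trans _ _ (e / 2 * (g v ^+ 2 * (g v / 2)) * N)).
  by have := ler_wpM2r N0 h; lra.
rewrite mulrAC ler_wpM2l ?mulr_ge0 ?(ltW e0)// ler_wpM2l ?(ltW g20)//.
Qed.

End FirstOrderExpansion.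

(** * Linearization and contraction near a stable equilibrium *)

Section StableEquilibrium.
Variables (R : realType) (n : nat) (alpha : R) (p : {set 'I_n} -> R).
Hypotheses (hn : (0 < n)%N) (halpha : 1 < alpha) (hp : is_subset_distr p).
Variable v : 'rV[R]_n.
Hypothesis hv : equilibria alpha p v.

Let p_ge0 B : 0 <= p B. Proof. by case: hp. Qed.
Let v0 i : 0 <= v 0 i. Proof. by case: hv => -[]. Qed.

(* The coordinates of [drift v] sum to minus the mass of the subsets on which
   [v] vanishes. *)
Lemma equilibrium_powsum_gt0 (B : {set 'I_n}) : 0 < p B -> 0 < powsum alpha v B.
Proof.
move=> pB; have [[_ vs] Fv] := hv.
rewrite lt_neqAle powsum_ge0 andbT eq_sym; apply/negP => /eqP sB.
have : \sum_i drift alpha p v 0 i = 0 by rewrite Fv big1// => i _; rewrite mxE.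
under eq_bigr do rewrite driftE.
rewrite big_split /= sumrN vs (exchange_big_dep predT)//= (bigD1 B)//=.
under eq_bigr do rewrite sB invr0 mulr0 mulr0.
rewrite big1// add0r.
have : \sum_(C : {set 'I_n} | C != B) \sum_(i in C) p C * (v 0 i `^ alpha / powsum alpha v C)
   <= \sum_(C : {set 'I_n} | C != B) p C.
  apply: ler_sum => C _; rewrite -mulr_sumr ler_piMr// -mulr_suml.
  have [->|s0] := eqVneq (powsum alpha v C) 0; first by rewrite invr0 mulr0.
  by rewrite divff.
have [_ ps] := hp; rewrite (bigD1 B)//= in ps; lra.
Qed.

(** Certifies the closed form [drift_jacobian] as the derivative of the drift along the closed
    orthant: quotient rule for each subset, then regrouping by coordinate. *)
Lemma drift_expands i :
  expands v (fun x => drift alpha p x 0 i)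
    (fun y => \sum_k drift_jacobian alpha p v i k * y 0 k).
Proof.
have ha := halpha.
pose lB (B : {set 'I_n}) (y : 'rV[R]_n) : R := p B *
  ((alpha * v 0 i `^ (alpha - 1) * y 0 i * powsum alpha v B
   - v 0 i `^ alpha * \sum_(j in B) alpha * v 0 j `^ (alpha - 1) * y 0 j) / powsum alpha v B ^+ 2).
have H : expands v (fun x => drift alpha p x 0 i)
    (fun y => (-1) * y 0 i + \sum_(B : {set 'I_n} | i \in B) lB B y).
  have -> : (fun x => drift alpha p x 0 i) = (fun x => (-1) * x 0 i +
     \sum_(B : {set 'I_n} | i \in B) p B * (x 0 i `^ alpha / powsum alpha x B)).
    by apply/funext => x; rewrite driftE mulN1r.
  apply: expandsD; first by apply: expandsZ; exact: expands_coord.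
  apply: expands_sum => B iB.
  (* If [p B = 0], [powsum] may vanish at [v] and the quotient rule fails, but the whole term is
     0. *)
  have := p_ge0 B; rewrite le_eqVlt => /predU1P[pB|pB].
    rewrite /lB -pB.
    have -> : (fun x : 'rV[R]_n => 0 * (x 0 i `^ alpha / powsum alpha x B)) = fun=> 0.
      by apply/funext => x; rewrite mul0r.
    by apply: eq_expands (expands0 v) => y; rewrite mul0r.
  apply: expandsZ; apply: (@expands_div _ _ v (fun x => x 0 i `^ alpha)
     (fun x => powsum alpha x B)).
  - exact: expands_powR.
  - by apply: expands_sum => j _; exact: expands_powR.
  - exact: equilibrium_powsum_gt0.
apply: eq_expands H => y.
rewrite [RHS](bigD1 i)//= mxE eqxx mulrDl -addrA; congr (_ + _).
have -> : \sum_(k < n | k != i) drift_jacobian alpha p v i k * y 0 k =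
   - \sum_(B : {set 'I_n} | i \in B) \sum_(k in B | k != i)
      p B * (v 0 i `^ alpha * (alpha * v 0 k `^ (alpha - 1) * y 0 k) / powsum alpha v B ^+ 2).
  rewrite (exchange_big_dep (fun k => k != i))/=; last by move=> B k _ /andP[].
  rewrite -sumrN; apply: eq_bigr => k ki; rewrite mxE (negbTE ki) mulNr; congr (- _).
  rewrite mulr_sumr mulr_suml; apply: eq_big => [B|B _]; first by rewrite /= andbT.
  by ring.
rewrite mulr_sumr mulr_suml -sumrB; apply: eq_bigr => B iB.
rewrite /lB (bigD1 i)//=.
have -> : \sum_(k in B | k != i) p B * (v 0 i `^ alpha * (alpha * v 0 k `^ (alpha - 1) * y 0 k) / powsum alpha v B ^+ 2)
  = p B * (v 0 i `^ alpha * (\sum_(k in B | k != i) alpha * v 0 k `^ (alpha - 1) * y 0 k) / powsum alpha v B ^+ 2).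
  by rewrite mulr_sumr mulr_suml mulr_sumr.
by ring.
Qed.

(* Reciprocal weights symmetrize the Jacobian: on the support of [v] the drift
   is [v_i] times the gradient of the Lyapunov function, up to projection. *)
Definition weight (i : 'I_n) : R := if v 0 i == 0 then 1 else (v 0 i)^-1.

Lemma weight_ge1 i : 1 <= weight i.
Proof.
rewrite /weight; case: eqP => // /eqP vi.
have vi0 : 0 < v 0 i by rewrite lt_neqAle eq_sym vi v0.
rewrite -[leLHS]invr1 lef_pV2 ?posrE//.
by have /andP[] := simplex_le1 i hv.1.
Qed.

Lemma weight_gt0 i : 0 < weight i.
Proof. exact: lt_le_trans (weight_ge1 i). Qed.

Lemma weight_jacobian_sym i k :
  weight i * drift_jacobian alpha p v i k = weight k * drift_jacobian alpha p v k i.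
Proof.
have ha := halpha; have a0 : alpha != 0 by rewrite gt_eqF//; lra.
have a10 : alpha - 1 != 0 by rewrite gt_eqF//; lra.
have [->//|ik] := eqVneq i k.
rewrite !mxE (negbTE ik) eq_sym (negbTE ik).
(* This identity also holds at [v_j = 0], both sides being 0 because [alpha > 1]; it makes the
   off-diagonal entries symmetric in [i] and [k]. *)
have E j : weight j * v 0 j `^ alpha = v 0 j `^ (alpha - 1).
  rewrite /weight; case: eqP => [->|/eqP vj]; first by rewrite !powR0 ?mulr0.
  rewrite -(@mulr_powRB1 _ (v 0 j) alpha)//; last by lra.
  by rewrite mulrA mulVf// mul1r.
rewrite (eq_bigl (fun B : {set 'I_n} => (k \in B) && (i \in B))); last first.
  by move=> B; rewrite andbC.
set S := \sum_(B | _) _.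
transitivity (- (alpha * v 0 k `^ (alpha - 1) * (weight i * v 0 i `^ alpha) * S)); first by ring.
by rewrite E -E; ring.
Qed.

Lemma stable_local_contraction : linearly_stable alpha p v ->
  exists c d, [/\ 0 < c, 0 < d & forall x : 'rV[R]_n, (forall i, 0 <= x 0 i) ->
    `|x - v| < d -> \sum_i weight i * (x 0 i - v 0 i) * drift alpha p x 0 i
       <= - c * \sum_i weight i * (x 0 i - v 0 i) ^+ 2].
Proof.
move=> st; have [c c0 Hc] := rayleigh_bound hn weight_gt0 weight_jacobian_sym st.
pose S := \sum_i weight i.
have S0 : 0 <= S by apply: sumr_ge0 => i _; exact/ltW/weight_gt0.
(* Half of the rate [c] pays for the linearization error, which is summed with total weight [S]; the
   added 1 keeps the denominator positive. *)
have e0 : 0 < c / 2 / (S + 1) by rewrite !divr_gt0// ltr_wpDl.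
have : nbhs v [set x : 'rV[R]_n | forall i, (forall i, 0 <= x 0 i) ->
   `|drift alpha p x 0 i - drift alpha p v 0 i - \sum_k drift_jacobian alpha p v i k * (x - v) 0 k|
    <= c / 2 / (S + 1) * `|x - v|].
  apply: (filter_forall (F := nbhs v)) => i.
  by have [_ +] := drift_expands i; apply.
move=> /nbhs_ballP[d /= d0 H]; exists (c / 2), d; split=> //; first by rewrite divr_gt0.
move=> x x0 xd; have {}H := H x _ _ x0; rewrite -ball_normE /= distrC in H.
pose y := x - v.
have yE i : x 0 i - v 0 i = y 0 i by rewrite !mxE.
under [leLHS]eq_bigr do rewrite yE; under [X in _ <= _ * X]eq_bigr do rewrite yE.
set Q := \sum_i weight i * y 0 i ^+ 2.
have NQ : `|y| ^+ 2 <= Q.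
  apply: le_trans (norm_rV_sqr y) _; apply: ler_sum => i _.
  by rewrite ler_peMl ?sqr_ge0// weight_ge1.
have : \sum_i weight i * y 0 i * drift alpha p x 0 i <=
   \sum_i weight i * y 0 i * (\sum_k drift_jacobian alpha p v i k * y 0 k)
   + \sum_i weight i * (c / 2 / (S + 1) * `|y| ^+ 2).
  rewrite -big_split /=; apply: ler_sum => i _.
  rewrite -!mulrA -mulrDr ler_wpM2l ?(ltW (weight_gt0 i))//.
  have := H xd i; have -> : drift alpha p v 0 i = 0 by case: hv => _ ->; rewrite mxE.
  rewrite subr0 -/y; set F := drift alpha p x 0 i; set J := \sum_k _ => h.
  have : y 0 i * (F - J) <= c / 2 / (S + 1) * `|y| ^+ 2.
    apply: le_trans (ler_norm _) _; rewrite normrM expr2 mulrA mulrC.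
    by apply: ler_pM => //; exact: ler_coord_norm.
  lra.
have := Hc y; rewrite -/Q -mulr_suml -/S => h1 h2.
have h3 : S * (c / 2 / (S + 1) * `|y| ^+ 2) <= c / 2 * Q.
  have -> : S * (c / 2 / (S + 1) * `|y| ^+ 2) = c / 2 * (S / (S + 1) * `|y| ^+ 2) by ring.
  rewrite ler_wpM2l ?divr_ge0 ?(ltW c0)//; apply: le_trans NQ.
  by rewrite ler_piMl ?sqr_ge0// ler_pdivrMr ?ltr_wpDl// mul1r lerDl.
lra.
Qed.

End StableEquilibrium.

(** * Positive probability of convergence *)

Section PositiveProbability.
Variables (R : realType) (n : nat) (alpha : R) (p : {set 'I_n} -> R).
Variables (d : measure_display) (T : measurableType d) (P : probability T R).
Variables (A : nat -> T -> {set 'I_n}) (C : nat -> T -> 'I_n)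
  (N : nat -> 'I_n -> T -> nat).
Hypotheses (hn : (0 < n)%N) (halpha : 1 < alpha).
Hypotheses (hp : is_subset_distr p) (hp0 : p finset.set0 = 0).
Hypothesis hW : is_WARM alpha p P A C N.
Variable v : 'rV[R]_n.
Hypothesis hv : equilibria alpha p v.

Let p_ge0 B : 0 <= p B. Proof. by case: hp. Qed.
Let v0 i : 0 <= v 0 i. Proof. by case: hv => -[]. Qed.

(** Otherwise the drift in coordinate [i] would reduce to [- v_i], which is not 0. *)
Lemma equilibrium_support (i : 'I_n) : exists B : {set 'I_n},
  v 0 i != 0 -> i \in B /\ 0 < p B.
Proof.
have [vi|vi] := eqVneq (v 0 i) 0; first by exists finset.set0 => /eqP.
have [/existsP[B /andP[iB pB]]|/existsPn H] :=
    boolP [exists B : {set 'I_n}, (i \in B) && (0 < p B)]; first by exists B.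
have : drift alpha p v 0 i = 0 by case: hv => _ ->; rewrite mxE.
rewrite driftE big1 ?addr0; first by move/eqP; rewrite oppr_eq0 (negbTE vi).
move=> B iB; have := H B; rewrite iB /= -leNgt => pB.
by have -> : p B = 0 by [apply/le_anti; rewrite pB p_ge0]; rewrite mul0r.
Qed.

Lemma law_gt0 (h : seq (draw n)) : all (fun x : draw n => (x.2 \in x.1) && (0 < p x.1)) h ->
  0 < law alpha p h.
Proof.
elim: h => //= x h IH /andP[/andP[x1 x2] /IH h1].
by rewrite mulr_gt0// mulr_gt0// selection_prob_gt0.
Qed.

(** Colours of the support are drawn from charged subsets containing them, so the history has
    positive law. Its length makes the noise still to come small. *)
Lemma reachable (e : R) : 0 < e -> exists h : seq (draw n),
  [/\ 0 < law alpha p h, `|fractions R h - v| <= e & (size h + n)%:R^-1 <= e].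
Proof.
move=> e0; have [f Hf] := choice equilibrium_support.
pose k : R := (Num.bound (n%:R / e)).+1%:R; have k0 : 0 < k by rewrite ltr0n.
have nke : n%:R / k <= e.
  rewrite ler_pdivrMr// mulrC -ler_pdivrMr//; apply/ltW.
  apply: (@lt_le_trans _ _ (Num.bound (n%:R / e))%:R); last by rewrite ler_nat.
  by apply: archi_boundP; rewrite divr_ge0// ltW.
(* Rounding down gives no draw to colours outside the support. With the initial balls the total lies
   between [k] and [k + n], hence an error of at most [n / k] in each fraction. *)
pose m i := Num.truncn (k * v 0 i).
have mP i : (m i)%:R <= k * v 0 i < (m i).+1%:R by apply: truncn_itv; rewrite mulr_ge0// ltW.
pose h : seq (draw n) := flatten [seq nseq (m i) (f i, i) | i <- enum 'I_n].
have hballs i : balls h i = (m i).+1.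
  rewrite /balls /h count_flatten -map_comp sumnE big_map big_enum /=.
  rewrite (bigD1 i)//= count_nseq /= eqxx mul1n big1 ?addn0// => j ji.
  by rewrite count_nseq /= (negbTE ji).
have size_h : (size h + n)%:R = \sum_i (m i).+1%:R :> R.
  by rewrite -sum_balls natr_sum; apply: eq_bigr => i _; rewrite hballs.
have sum_kv : \sum_i k * v 0 i = k by rewrite -mulr_sumr; case: hv => -[_ ->] _; rewrite mulr1.
have size_ge : k <= (size h + n)%:R.
  by rewrite size_h -[leLHS]sum_kv; apply: ler_sum => i _; have /andP[_ /ltW] := mP i.
have size_le : (size h + n)%:R <= k + n%:R.
  rewrite size_h -sum_kv -[X in _ + X%:R]card_ord -sum1_card natr_sum -big_split /=.
  by apply: ler_sum => i _; have /andP[+ _] := mP i; rewrite -natr1 lerD2r.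
have size0 : 0 < (size h + n)%:R :> R by apply: lt_le_trans size_ge.
exists h; split.
- apply: law_gt0; apply/allP => x /flattenP[s /mapP[i _ ->]].
  rewrite mem_nseq => /andP[mi /eqP -> /=].
  have vi : v 0 i != 0.
    by apply/eqP => vi; move: mi; rewrite /m vi mulr0 truncn0.
  by have [-> ->] := Hf i vi.
- apply: norm_rV_le; first exact: ltW.
  move=> i; rewrite !mxE hballs; apply: le_trans nke.
  set D := (size h + n)%:R in size_ge size_le size0 *.
  have -> : (m i).+1%:R / D - v 0 i = ((m i).+1%:R - v 0 i * D) / D.
    by rewrite mulrBl mulfK// gt_eqF.
  rewrite normrM normfV (gtr0_norm size0).
  apply: ler_pM => //; rewrite ?invr_ge0 ?(ltW size0)//; last by rewrite lef_pV2 ?posrE.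
  have /andP[m1 m2] := mP i; have /andP[vi0 vi1] := simplex_le1 i hv.1.
  rewrite -natr1 in m2 *.
  have h1 : v 0 i * k <= v 0 i * D by rewrite ler_wpM2l.
  have h2 : v 0 i * D <= v 0 i * (k + n%:R) by rewrite ler_wpM2l.
  have h3 : v 0 i * n%:R <= n%:R by rewrite ler_piMl.
  have h4 : 1 <= n%:R :> R by rewrite ler1n.
  by rewrite ler_norml; apply/andP; split; lra.
- apply: le_trans nke; apply: (@le_trans _ _ k^-1); first by rewrite lef_pV2 ?posrE.
  by rewrite ler_peMl ?invr_ge0 ?(ltW k0)// ler1n.
Qed.

Definition wdist (h : seq (draw n)) : R :=
  \sum_i weight v i * (fractions R h 0 i - v 0 i) ^+ 2.

Lemma wdist_ge0 h : 0 <= wdist h.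
Proof.
by apply: sumr_ge0 => i _; rewrite mulr_ge0 ?sqr_ge0// ltW// (weight_gt0 hv).
Qed.

Lemma norm_le_wdist h : `|fractions R h - v| ^+ 2 <= wdist h.
Proof.
apply: le_trans (norm_rV_sqr _) _; apply: ler_sum => i _; rewrite !mxE.
by rewrite ler_peMl ?sqr_ge0// (weight_ge1 hv).
Qed.

Lemma wdist_le_norm h : wdist h <= (\sum_i weight v i) * `|fractions R h - v| ^+ 2.
Proof.
rewrite mulr_suml; apply: ler_sum => i _; rewrite ler_wpM2l ?(ltW (weight_gt0 hv i))//.
rewrite -[leLHS]real_normK ?num_real// ler_pXn2r ?nnegrE//.
by have := ler_coord_norm (fractions R h - v) i; rewrite !mxE.
Qed.

(** Expansion of the square: the mean of the linear term is the drift, and each coordinate moves by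
    at most the step size. *)
Lemma mean_wdist_step h :
  \sum_x step_prob alpha p h x * wdist (x :: h) <=
  wdist h + 2 * step_size n (size h) *
     (\sum_i weight v i * (fractions R h 0 i - v 0 i) * drift alpha p (fractions R h) 0 i)
  + (\sum_i weight v i) * step_size n (size h) ^+ 2.
Proof.
set g := step_size n (size h); set X := fractions R h.
pose phi (j : 'I_n) : R := wdist h
  + 2 * g * (\sum_i weight v i * (X 0 i - v 0 i) * ((j == i)%:R - X 0 i))
  + (\sum_i weight v i) * g ^+ 2.
apply: (@le_trans _ _ (\sum_x step_prob alpha p h x * phi x.2)).
  apply: ler_sum => x _; rewrite ler_wpM2l ?step_prob_ge0//.
  rewrite /phi /wdist mulr_sumr mulr_suml -!big_split /=; apply: ler_sum => i _.
  rewrite fractions_cons// -/X -/g.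
  set b : R := (x.2 == i)%:R - X 0 i.
  have -> : weight v i * (X 0 i + g * b - v 0 i) ^+ 2 =
    weight v i * (X 0 i - v 0 i) ^+ 2 + 2 * g * (weight v i * (X 0 i - v 0 i) * b)
    + weight v i * (g ^+ 2 * b ^+ 2) by ring.
  rewrite lerD2l ler_wpM2l ?(ltW (weight_gt0 hv i))// ler_piMr ?sqr_ge0//.
  have /andP[X0 X1] := simplex_le1 i (@fractions_simplex R n hn h).
  rewrite -[leLHS]real_normK ?num_real// expr_le1// ler_norml /b -/X.
  by case: eqP => _; rewrite /=; apply/andP; split; lra.
rewrite sum_step_colour /phi.
under eq_bigr do rewrite 2!mulrDr.
rewrite !big_split /= -!mulr_suml sum_colour_prob// !mul1r lerD2r lerD2l.
rewrite [X in _ <= X]mulr_sumr; under eq_bigr do rewrite mulrCA mulr_sumr mulr_sumr.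
rewrite exchange_big /=; apply: ler_sum => i _.
have -> : \sum_(j < n) 2 * g * (colour_prob alpha p h j * (weight v i * (X 0 i - v 0 i) * ((j == i)%:R - X 0 i)))
  = 2 * g * (weight v i * (X 0 i - v 0 i)) * \sum_j colour_prob alpha p h j * ((j == i)%:R - X 0 i).
  by rewrite mulr_sumr; apply: eq_bigr => j _; ring.
have -> : \sum_j colour_prob alpha p h j * ((j == i)%:R - X 0 i) = drift alpha p X 0 i.
  by rewrite sum_colour_prob_centered// colour_prob_drift// -/X addrAC subrr add0r.
by rewrite -!mulrA.
Qed.

Lemma measurable_converge :
  measurable [set w | (fun t => proportions R N t w) @ \oo --> v].
Proof.
rewrite (_ : [set w | _] = \bigcap_k \bigcup_m \bigcap_(t in [set t | (m <= t)%N])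
    [set w | `|v - fractions R (hist A C t w)| < k.+1%:R^-1]).
  apply: bigcapT_measurable => k; apply: bigcup_measurable => m _.
  apply: bigcap_measurable; first by exists m => /=.
  move=> t _.
  exact: (measurable_hist hW t (fun h => `|v - fractions R h| < k.+1%:R^-1)).
apply/seteqP; split=> w /=.
  move=> /cvgrPdist_lt H k _.
  have /H[m _ Hm] : 0 < k.+1%:R^-1 :> R by rewrite invr_gt0 ltr0n.
  by exists m => // t /Hm /=; rewrite (proportions_hist hW).
move=> H; apply/cvgrPdist_lt => e e0; pose k := Num.bound e^-1.
have [m _ Hm] := H k I; exists m => // t /= mt; rewrite (proportions_hist hW).
apply: lt_le_trans (Hm t mt) _.
rewrite -[leRHS]invrK lef_pV2 ?posrE ?invr_gt0 ?ltr0n//.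
apply: (@le_trans _ _ k%:R); last by rewrite ler_nat.
by apply/ltW/archi_boundP; rewrite invr_ge0 ltW.
Qed.

Lemma converge_positive_probability : linearly_stable alpha p v ->
  (0 < P [set w | (fun t => proportions R N t w) @ \oo --> v])%E.
Proof.
move=> st; have [c [dl [c0 dl0 contract]]] := stable_local_contraction hn halpha hp hv st.
pose W := \sum_i weight v i.
have W0 : 0 < W.
  rewrite /W (bigD1 (Ordinal hn))//= ltr_wpDr ?(weight_gt0 hv)//.
  by apply: sumr_ge0 => i _; rewrite ltW// (weight_gt0 hv).
(* The level [r] keeps the path within [dl / 2] of [v], so that its cluster points are still within
   the contraction radius [dl]. *)
pose r := (dl / 2) ^+ 2; have r0 : 0 < r by rewrite exprn_gt0// divr_gt0.
have near_v h : wdist h < r -> `|fractions R h - v| < dl / 2.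
  move=> H; rewrite -(@ltr_pXn2r _ 2)// ?nnegrE ?divr_ge0 ?(ltW dl0)//.
  exact: le_lt_trans (norm_le_wdist h) H.
(* The initial distance and the future noise each cost at most [W * e <= r / 4], so at most half of
   the mass [law h0] escapes; [e <= 1] gives [e ^+ 2 <= e]. *)
pose e := Num.min 1 (r / (4 * W)).
have e0 : 0 < e by rewrite lt_min ltr01 divr_gt0// mulr_gt0.
have e1 : e <= 1 by rewrite ge_min lexx.
have We : W * e <= r / 4.
  apply: (@le_trans _ _ (W * (r / (4 * W)))).
    by rewrite ler_wpM2l ?(ltW W0)// ge_min lexx orbT.
  by have -> : W * (r / (4 * W)) = r / 4 by field; rewrite gt_eqF.
have [h0 [law0 h0v h0s]] := reachable e0.
have start : wdist h0 + W * (size h0 + n)%:R^-1 <= r / 2.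
  have h1 : wdist h0 <= W * e.
    apply: le_trans (wdist_le_norm h0) _; rewrite ler_wpM2l ?(ltW W0)//.
    have := normr_ge0 (fractions R h0 - v); nra.
  have := ler_wpM2l (ltW W0) h0s; lra.
have G_step h : (size h0 <= size h)%N -> wdist h < r ->
    \sum_x step_prob alpha p h x * wdist (x :: h) <= wdist h + W * step_size n (size h) ^+ 2.
  move=> _ hr; apply: le_trans (mean_wdist_step h) _; rewrite lerD2r gerDl.
  rewrite -mulrA pmulr_rle0// pmulr_rle0 ?step_size_gt0//.
  apply: le_trans (contract _ _ _) _.
  - by move=> i; exact/ltW/fractions_gt0.
  - by have := near_v _ hr; lra.
  - by rewrite mulNr oppr_le0 mulr_ge0 ?(ltW c0)// wdist_ge0.
pose bad := fun h => from h0 h && ~~ stay h0 wdist r h.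
pose esc := \bigcup_t [set w | bad (hist A C t w)].
have mesc : measurable esc.
  by apply: bigcup_measurable => t _; exact: (measurable_hist hW t bad).
have Pesc : (P esc <= (law alpha p h0 / 2)%:E)%E.
  apply: measure_nondecreasing_bigcup_le.
  - by move=> t; exact: (measurable_hist hW t bad).
  - by move=> t w /= H; exact: escape_cons.
  - move=> t; have [ht|ht] := ltnP t (size h0).
      rewrite (_ : [set w | _] = set0); first by rewrite measure0 lee_fin divr_ge0// ltW.
      by apply/seteqP; split=> // w /=; rewrite /bad from_small// size_hist.
    apply: le_trans (prob_hist_le hW t bad) _; rewrite lee_fin.
    rewrite -(ler_pM2r r0).
    apply: le_trans (mean_escape hn hp hp0 (ltW W0) wdist_ge0 G_step ht) _.
    by have := ler_wpM2l (ltW law0) start; lra.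
have [Z [mZ PZ HZ]] := ae_drift_vanishes hn halpha hp hp0 hW.
have cover : [set w | hist A C (size h0) w = h0] `<=`
   [set w | (fun t => proportions R N t w) @ \oo --> v] `|` (esc `|` Z).
  move=> w /= hw; have [|nZ] := pselect (Z w); first by right; right.
  have [|nesc] := pselect (esc w); first by right; left.
  left; have van : forall e, 0 < e -> exists t0, forall t, (t0 <= t)%N ->
      core p (proportions R N t w) /\ `|drift alpha p (proportions R N t w)| < e.
    by apply: contrapT => H; apply: nZ; exact: HZ.
  have hfrom k : from h0 (hist A C (size h0 + k) w).
    elim: k => [|k IH]; last by rewrite addnS /= IH orbT.
    by rewrite addn0 hw from_size// eqxx.
  have hstay t : (size h0 <= t)%N -> `|proportions R N t w - v| < dl / 2.
    move=> /subnKC <-; rewrite (proportions_hist hW); apply: near_v.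
    apply: (@stay_lt _ _ h0); apply: contrapT => /negP H; apply: nesc.
    by exists (size h0 + (t - size h0))%N => //=; rewrite /bad hfrom H.
  apply: (@cvg_unique_cluster _ _ _ _ 1).
    by move=> t; apply: simplex_norm_le1; exact: (proportions_simplex hn hW).
  move=> y cy; have [[y0 _] Fy] := cluster_equilibrium halpha hp van cy.
  have dl20 : 0 < dl / 2 by rewrite divr_gt0.
  have [t ht yt] := cluster_frequentlyT cy (size h0) dl20.
  have yv : `|y - v| < dl.
    have -> : y - v = (proportions R N t w - v) - (proportions R N t w - y).
      by rewrite opprB [RHS]addrC addrA subrK.
    by apply: le_lt_trans (ler_normB _ _) _; have := hstay t ht; lra.
  (* At an equilibrium [y] of the ball the drift is 0, so contraction forces the weighted square
     distance to [v] to be 0. *)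
  have := contract y y0 yv; rewrite Fy.
  under eq_bigr do rewrite mxE mulr0.
  rewrite big1// mulNr oppr_ge0 pmulr_rle0// => H.
  apply/rowP => i; apply/eqP; rewrite -subr_eq0 -sqrf_eq0 eq_le sqr_ge0 andbT.
  rewrite -(pmulr_rle0 _ (weight_gt0 hv i)); apply: le_trans H; rewrite (bigD1 i)//= lerDl.
  by apply: sumr_ge0 => j _; rewrite mulr_ge0 ?sqr_ge0// ltW// (weight_gt0 hv).
have mconv := measurable_converge.
rewrite lt0e measure_ge0 andbT; apply/eqP => Pc0.
have : (P [set w | hist A C (size h0) w = h0] <= P esc)%E.
  apply: (@le_trans _ _ (P ([set w | (fun t => proportions R N t w) @ \oo --> v] `|` (esc `|` Z)))).
    rewrite le_measure ?inE//; first exact: (measurable_hist_eq hW).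
    by apply: measurableU => //; exact: measurableU.
  apply: le_trans (measureU2 _ _ _) _ => //; first exact: measurableU.
  rewrite [X in (X + _)%E](_ : _ = 0%E)// add0e.
  by apply: le_trans (measureU2 _ _ _) _ => //; rewrite [X in (_ + X)%E](_ : _ = 0%E)// adde0.
(* If convergence had probability 0, the mass [law h0 > 0] of the starting history would be at most
   [law h0 / 2]. *)
rewrite (law_hist hW) => /le_trans /(_ Pesc); rewrite lee_fin; lra.
Qed.

End PositiveProbability.

Theorem theorem1p14 (R : realType) (n : nat) (alpha : R) (p : {set 'I_n} -> R)
    (d : measure_display) (T : measurableType d) (P : probability T R)
    (A : nat -> T -> {set 'I_n}) (C : nat -> T -> 'I_n)
    (N : nat -> 'I_n -> T -> nat)
    (hn : (1 <= n)%N) (halpha : 1 < alpha)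
    (hp : is_subset_distr p) (hp0 : p finset.set0 = 0)
    (hW : is_WARM alpha p P A C N) :
  {ae P, forall w,
     accumulation_points R N w `<=` equilibria alpha p /\
     accumulation_points R N w `<=` simplex R n /\
     connected (accumulation_points R N w)} /\
  (forall v : 'rV[R]_n, stable_equilibria alpha p v ->
     (0 < P [set w | (fun t => proportions R N t w) @ \oo --> v])%E).
Proof.
split=> [|v [ev sv]]; last exact: (converge_positive_probability hn halpha hp hp0 hW ev sv).
apply: filterS (ae_drift_vanishes hn halpha hp hp0 hW) => w van.
have sub : accumulation_points R N w `<=` equilibria alpha p.
  by move=> y; apply: cluster_equilibrium.
split=> //; split; first by move=> y /sub[].
exact: (proportions_cluster_connected hn hW).
Qed.
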